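(* Let $G=\mathrm{SL}(3,\mathbb R)$, $I_{2,1}=\mathrm{diag}(1,1,-1)$, $\sigma(M)=I_{2,1}\,{}^tM^{-1}I_{2,1}$, let $H$ be the identity component of the fixed-point group $G^\sigma=\mathrm{SO}(2,1)$, and let $\mathfrak q=\{A\in\mathfrak{sl}(3,\mathbb R): I_{2,1}\,{}^tA\,I_{2,1}=A\}$. Let $\mathscr Z(\mathfrak q)$ be the $C^\infty(\mathfrak q)^H$-module of all smooth $H$-invariant vector fields on $\mathfrak q$ that annihilate every function in $C^\infty(\mathfrak q)^H$. Then the set of elements of $\mathscr Z(\mathfrak q)$ with polynomial coefficients does not generate $\mathscr Z(\mathfrak q)$ as a $C^\infty(\mathfrak q)^H$-module.
   Context: $H$ acts on $\mathfrak q$ by conjugation ($\mathfrak q$ is the $(-1)$-eigenspace in $\mathfrak{sl}(3,\mathbb R)$ of the differential of $\sigma$, $A\mapsto -I_{2,1}\,{}^tA\,I_{2,1}$). $C^\infty(\mathfrak q)^H$ is the algebra of $H$-invariant complex-valued smooth functions on $\mathfrak q$. A smooth vector field on $\mathfrak q$ is a smooth map $X:\mathfrak q\to\mathfrak q_{\mathbb C}$ (the complexification of $\mathfrak q$), acting on functions by directional derivatives extended $\mathbb C$-linearly; it is $H$-invariant if $X(h\cdot x)=h\cdot X(x)$ for all $h\in H$, $x\in\mathfrak q$. It has polynomial coefficients if it is a polynomial map. *)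

(* Defs.v *)
From HB Require Import structures.
From mathcomp Require Import all_boot all_order all_algebra.
From mathcomp Require Import complex.
From mathcomp Require mpoly.
From mathcomp Require Import all_classical all_reals all_analysis.

Set Implicit Arguments.
Unset Strict Implicit.
Unset Printing Implicit Defensive.

Import Order.TTheory GRing.Theory Num.Theory.
Import numFieldNormedType.Exports.

Local Open Scope classical_set_scope.
Local Open Scope ring_scope.

Section Space.
Variable K : comUnitRingType.
Implicit Types A B h : 'M[K]_3.

Definition I21 : 'M[K]_3 :=
  diag_mx (\row_(j < 3) (if j == ord_max then -1 else 1)).

Definition qpred : {pred 'M[K]_3} :=
  [pred A : 'M[K]_3 | (I21 *m A^T *m I21 == A) && (\tr A == 0)].

Lemma qpred_submod_closed : submod_closed qpred.
Proof.
split=> [|a A B]; rewrite !inE ?trmx0 ?mulmx0 ?mul0mx ?mxtrace0 ?eqxx //.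
move=> /andP[/eqP hA /eqP tA] /andP[/eqP hB /eqP tB].
rewrite linearP /= mulmxDr mulmxDl -scalemxAr -scalemxAl hA hB.
by rewrite mxtraceD mxtraceZ tA tB mulr0 addr0 !eqxx.
Qed.

HB.instance Definition _ :=
  GRing.isSubmodClosed.Build K 'M[K]_3 qpred qpred_submod_closed.

(* [qspace R] is the space q; as the equations defining q have real
   coefficients, [qspace R[i]] is its complexification. *)
Record qspace := QSpace { qmx :> 'M[K]_3; _ : qmx \in qpred }.

HB.instance Definition _ := [isSub for qmx].
HB.instance Definition _ := [Choice of qspace by <:].
HB.instance Definition _ := [SubChoice_isSubLmodule of qspace by <:].

Definition sigma h : 'M[K]_3 := I21 *m (invmx h)^T *m I21.

(* The default value [x] is never used when [h] is fixed by [sigma]: see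
   [qmx_qconj] below. *)
Definition qconj h (x : qspace) : qspace :=
  insubd x (h *m qmx x *m invmx h).

Lemma I21K : I21 *m I21 = 1%:M.
Proof.
rewrite mulmx_diag -diag_const_mx; congr diag_mx.
by apply/rowP=> j; rewrite !mxE; case: ifP; rewrite ?mulrNN mulr1.
Qed.

Lemma trI21 : I21^T = I21.
Proof. exact: tr_diag_mx. Qed.

Lemma qconj_subproof h (x : qspace) : h \in unitmx -> sigma h = h ->
  h *m qmx x *m invmx h \in qpred.
Proof.
case: x => A /= /andP[/eqP hA /eqP tA] uh sh; apply/andP; split; last first.
  by apply/eqP; rewrite mxtrace_mulC mulmxA mulVmx // mul1mx.
have sVh : I21 *m h^T *m I21 = invmx h.
  apply: (can_inj (mulKmx uh)); rewrite mulmxV // -{1}sh /sigma.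
  rewrite !mulmxA -(mulmxA _ I21 I21) I21K mulmx1 -(mulmxA I21) -trmx_mul.
  by rewrite mulmxV // trmx1 mulmx1 I21K.
apply/eqP; transitivity
  (sigma h *m (I21 *m A^T *m I21) *m (I21 *m h^T *m I21)); last first.
  by rewrite sh hA sVh.
rewrite !trmx_mul /sigma !mulmxA.
by do 2 rewrite -(mulmxA _ I21 I21) I21K mulmx1.
Qed.

Lemma qmx_qconj h (x : qspace) : h \in unitmx -> sigma h = h ->
  qmx (qconj h x) = h *m qmx x *m invmx h.
Proof. by move=> uh sh; apply: insubdK; exact: qconj_subproof. Qed.

End Space.

Section NormedSpace.
Variable R : realType.

Let qnorm (x : qspace R) : R := `|qmx x|.

Let ler_qnormD x y : qnorm (x + y) <= qnorm x + qnorm y.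
Proof. exact: ler_normD. Qed.

Let qnormZ (l : R) x : qnorm (l *: x) = `|l| * qnorm x.
Proof. exact: normrZ. Qed.

Let qnorm0_eq0 x : qnorm x = 0 -> x = 0.
Proof. by move=> /normr0_eq0 x0; apply/val_inj. Qed.

HB.instance Definition _ :=
  Lmodule_isNormed.Build R (qspace R) ler_qnormD qnormZ qnorm0_eq0.

End NormedSpace.

Section RealImaginaryParts.
Variable R : realType.
Implicit Types z : qspace R[i].

Let qpredP (K : comUnitRingType) (A : 'M[K]_3) :
  reflect ((forall i j, (if i == ord_max then -1 else 1) * A j i *
              (if j == ord_max then -1 else 1) = A i j) /\
           \sum_i A i i = 0) (A \in @qpred K).
Proof.
have E i j : (I21 K *m A^T *m I21 K) i j =
    (if i == ord_max then -1 else 1) * A j i *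
    (if j == ord_max then -1 else 1).
  by rewrite mul_mx_diag mul_diag_mx !mxE.
apply: (iffP andP) => -[h1 h2].
  by split; [move=> i j; rewrite -E (eqP h1) | exact/eqP].
by split; apply/eqP; [apply/matrixP=> i j; rewrite E h1 | exact: h2].
Qed.

Let qRe_subproof z : map_mx (@complex.Re R) (qmx z) \in @qpred R.
Proof.
case: z => A /= /qpredP[hA tA]; apply/qpredP; split=> [i j|].
  rewrite !mxE -(hA i j); case: (A j i) => a b.
  by case: ifP; case: ifP; rewrite ?(mul1r, mulr1, mulN1r, mulrN1).
under eq_bigr do rewrite mxE.
by rewrite -raddf_sum tA.
Qed.

Let qIm_subproof z : map_mx (@complex.Im R) (qmx z) \in @qpred R.
Proof.
case: z => A /= /qpredP[hA tA]; apply/qpredP; split=> [i j|].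
  rewrite !mxE -(hA i j); case: (A j i) => a b.
  by case: ifP; case: ifP; rewrite ?(mul1r, mulr1, mulN1r, mulrN1).
under eq_bigr do rewrite mxE.
by rewrite -raddf_sum tA.
Qed.

Definition qRe z : qspace R := QSpace (qRe_subproof z).
Definition qIm z : qspace R := QSpace (qIm_subproof z).

End RealImaginaryParts.

Section Smooth.
Variables (R : realType) (V : normedModType R).

Fixpoint Ck (n : nat) (f : V -> R) : Prop :=
  if n is n'.+1 then
    (forall x, differentiable f x) /\ (forall v, Ck n' (fun x => 'D_v f x))
  else continuous f.

(* On a finite-dimensional V such as q these are the C^oo functions; on an
   infinite-dimensional one this definition would be too weak. *)
Definition smooth (f : V -> R) : Prop := forall n, Ck n f.

Definition csmooth (f : V -> R[i]) : Prop :=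
  smooth (fun x => complex.Re (f x)) /\ smooth (fun x => complex.Im (f x)).

Definition cderive (v : V) (f : V -> R[i]) (x : V) : R[i] :=
  Complex ('D_v (fun y => complex.Re (f y)) x)
          ('D_v (fun y => complex.Im (f y)) x).

End Smooth.

Section Main.
Variable R : realType.

Definition Gsigma : set 'M[R]_3 := [set h | \det h = 1 /\ sigma h = h].

Definition Hgroup : set 'M[R]_3 := connected_component Gsigma 1%:M.

Definition qact (h : 'M[R]_3) (x : qspace R) : qspace R := qconj h x.

Definition qactC (h : 'M[R]_3) (z : qspace R[i]) : qspace R[i] :=
  qconj (map_mx (real_complex R) h) z.

Lemma qmx_qact h (x : qspace R) : Hgroup h ->
  qmx (qact h x) = h *m qmx x *m invmx h.
Proof.
move=> /connected_component_sub[dh sh]; apply: qmx_qconj => //.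
by rewrite unitmxE dh unitr1.
Qed.

Lemma qmx_qactC h (z : qspace R[i]) : Hgroup h ->
  let hC := map_mx (real_complex R) h in
  qmx (qactC h z) = hC *m qmx z *m invmx hC.
Proof.
move=> /connected_component_sub[dh sh] hC; apply: qmx_qconj.
  by rewrite /hC map_unitmx unitmxE dh unitr1.
have I21C : I21 R[i] = map_mx (real_complex R) (I21 R).
  apply/matrixP=> i j; rewrite !mxE rmorphMn /=; congr (_ *+ _).
  by case: ifP => _; rewrite ?rmorphN rmorph1.
by rewrite /sigma /hC I21C -map_invmx map_trmx -!map_mxM -[in RHS]sh.
Qed.

Definition CinfH : set (qspace R -> R[i]) :=
  [set f | csmooth f /\ forall h x, Hgroup h -> f (qact h x) = f x].

Definition vfield := qspace R -> qspace R[i].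

Definition vf_smooth (X : vfield) : Prop :=
  forall i j, csmooth (fun x => qmx (X x) i j).

Definition vf_invariant (X : vfield) : Prop :=
  forall h x, Hgroup h -> X (qact h x) = qactC h (X x).

(* The C-linear extension to q + iq of the directional derivative. *)
Definition vf_apply (X : vfield) (f : qspace R -> R[i]) (x : qspace R)
  : R[i] :=
  cderive (qRe (X x)) f x + Complex 0 1 * cderive (qIm (X x)) f x.

(* Polynomial functions on the subspace q are the restrictions of polynomials
   in the nine matrix entries. *)
Definition vf_polynomial (X : vfield) : Prop :=
  forall i j, exists p : mpoly.mpoly (3 * 3) R[i], forall x : qspace R,
    qmx (X x) i j =
    mpoly.meval (fun k => real_complex R (mxvec (qmx x) ord0 k)) p.

Definition Zq : set vfield :=
  [set X | [/\ vf_smooth X, vf_invariant X &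
    forall f, CinfH f -> forall x, vf_apply X f x = 0]].

(* The C^oo(q)^H-submodule spanned by [S]. *)
Definition vf_span (S : set vfield) : set vfield :=
  [set X | exists (n : nat) (a : 'I_n -> qspace R -> R[i]) (Y : 'I_n -> vfield),
    [/\ forall k, CinfH (a k), forall k, S (Y k) &
        forall x, X x = \sum_(k < n) a k x *: Y k x]].

(* Only meant for [S] contained in the module [M]. *)
Definition vf_generates (S M : set vfield) : Prop := M `<=` vf_span S.

End Main.

(* Main.v *)
(**
  The space q is the space of binary quartics under PSL(2, R); the binary
  quartic has no covariant of order 2, which makes every polynomial element of
  Z(q) vanish, while Z(q) itself does not.

  Polynomial elements.  Let Y be in Z(q).  At x = diag(a, 0, -a), Y(x) commutes
  with diag(-1, -1, 1) in H and is orthogonal to the differentials of tr x^2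
  and tr x^3, so that only its (1, 2) and (2, 1) entries can be nonzero.
  Conjugating by boosts in the (1, 3)-plane, the (1, 1) entry of Y vanishes at
  [[d, 0, 1], [0, 0, 0], [-1, 0, -d]] for all d > 1.  If Y is polynomial, this
  persists at d = 0, where the matrix, x0, is not diagonalisable over R.

  A smooth element.  Where tr x^2 < 0, x has a single real eigenvalue, and its
  eigenline is spacelike.  The sign of det(v, t, x t), for an eigenvector v, is
  the same for all timelike t; so there is a canonical choice of v, which is
  equivariant and smooth by Cardano's formula.  Identifying R^{2,1} with the
  Lie algebra of H, the field x |-> [v, x], cut off by a flat function of
  tr x^2, is tangent to the orbits and hence in Z(q); its (1, 1) entry at x0
  is not zero.
*)
From HB Require Import structures.
Require Import Defs.
From mathcomp Require Import all_boot all_order all_algebra.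
From mathcomp Require Import complex ring lra.
From mathcomp Require mpoly.
From mathcomp Require Import all_classical all_reals all_analysis.

Set Implicit Arguments.
Unset Strict Implicit.
Unset Printing Implicit Defensive.

Import Order.TTheory GRing.Theory Num.Theory.
Import numFieldNormedType.Exports.

Local Open Scope classical_set_scope.
Local Open Scope ring_scope.

(** * Functions of class C^k on an open set *)

Section SmoothOn.
Variable R : realType.

(** The first-order expansion at [x] depends only on the germ of the function there. *)
Lemma near_eq_differentiable (V W : normedModType R) (f g : V -> W) (x : V) :
  {near x, f =1 g} -> differentiable f x -> differentiable g x.
Proof.
move=> fg df; have [dc fo] := (diff_locallyP x f).1 df.
have go : g \o shift x = cst (g x) + 'd f x +o_ 0 id.
  apply/eqaddoP => e e0; have /eqaddoP/(_ _ e0) := fo.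
  have fg0 : \forall h \near 0, (f \o shift x) h = (g \o shift x) h.
    rewrite (near_shift x); apply: filterS fg => y fgy.
    by rewrite /= sub0r subrK.
  apply: filterS2 fg0 => h; rewrite !fctE /= => <-.
  by rewrite (nbhs_singleton fg).
by apply/diff_locallyP; rewrite (diff_unique dc go).
Qed.

Variable V : normedModType R.
Implicit Types (D : set V) (f g : V -> R).

(** A local form of [Ck], meant for open [D]: the field built below is smooth for different reasons
    on two open sets that cover q. *)
Fixpoint Ck_on D (n : nat) f : Prop :=
  if n is n'.+1 then
    (forall x, D x -> differentiable f x) /\
    (forall v, Ck_on D n' (fun x => 'D_v f x))
  else forall x, D x -> {for x, continuous f}.

Lemma Ck_onT n f : Ck_on setT n f -> Ck n f.
Proof.
elim: n f => [f fc x|n IH f [df dfn]]; first exact: fc.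
by split=> [x|v]; [exact: df | exact/IH/dfn].
Qed.

Lemma Ck_onS D n f : Ck_on D n.+1 f -> Ck_on D n f.
Proof.
elim: n f => [f [df _] x Dx|n IH f [df dfn]].
  exact/differentiable_continuous/df.
by split=> // v; exact/IH/dfn.
Qed.

Lemma open_near_eq D f g x : open D -> {in D, f =1 g} -> D x ->
  {near x, f =1 g}.
Proof.
move=> oD fg Dx; have : nbhs x D by exact: open_nbhs_nbhs.
by apply: filterS => y Dy; apply: fg; rewrite inE.
Qed.

Lemma eq_Ck_on D n f g : open D -> {in D, f =1 g} -> Ck_on D n f -> Ck_on D n g.
Proof.
move=> oD; elim: n f g => [|n IH] f g fg /=.
  move=> fc x Dx; have fgx := open_near_eq oD fg Dx.
  move: (fc x Dx); rewrite /prop_for /continuous_at (nbhs_singleton fgx).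
  by apply: cvg_trans; exact: near_eq_cvg.
move=> [df dfn]; split=> [x Dx|v].
  exact: near_eq_differentiable (open_near_eq oD fg Dx) (df x Dx).
apply: IH (dfn v) => x; rewrite inE => Dx.
exact: near_eq_derive (open_near_eq oD fg Dx).
Qed.

(** Gluing works because [f] and its derivatives are globally defined and each condition is
    pointwise. *)
Lemma Ck_onU D E n f : Ck_on D n f -> Ck_on E n f -> Ck_on (D `|` E) n f.
Proof.
elim: n f => [|n IH] f /=; first by move=> fD fE x [/fD|/fE].
by move=> [dD nD] [dE nE]; split=> [x [/dD|/dE]|v] //; exact: IH.
Qed.

Lemma Ck_on_cst D n (c : R) : Ck_on D n (fun=> c).
Proof.
elim: n c => [c x _|n IH c /=]; first exact: cvg_cst.
split=> [x _|v]; first exact: differentiable_cst.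
have -> : (fun x => 'D_v (fun=> c) x) = fun=> (0 : R) => //.
by apply/funext => x; exact: derive_cst.
Qed.

Lemma Ck_onD D n f g : open D -> Ck_on D n f -> Ck_on D n g ->
  Ck_on D n (fun x => f x + g x).
Proof.
move=> oD; elim: n f g => [|n IH] f g /=.
  by move=> fc gc x Dx; apply: continuousD; [exact: fc|exact: gc].
move=> [df fn] [dg gn]; split=> [x Dx|v].
  by apply: differentiableD; [exact: df|exact: dg].
apply: eq_Ck_on (IH _ _ (fn v) (gn v)) => // x; rewrite inE => Dx.
by rewrite -deriveD //; apply: diff_derivable; first [exact: df | exact: dg].
Qed.

Lemma Ck_onM D n f g : open D -> Ck_on D n f -> Ck_on D n g ->
  Ck_on D n (fun x => f x * g x).
Proof.
move=> oD; elim: n f g => [|n IH] f g.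
  by move=> fc gc x Dx; apply: continuousM; [exact: fc|exact: gc].
move=> fS gS; have [df fn] := fS; have [dg gn] := gS.
split=> [x Dx|v].
  by apply: differentiableM; [exact: df|exact: dg].
apply: (@eq_Ck_on _ _ (fun x => f x * 'D_v g x + g x * 'D_v f x)) => //.
  move=> x; rewrite inE => Dx.
  by rewrite deriveM //; apply: diff_derivable; first [exact: df | exact: dg].
by apply: Ck_onD => //; apply: IH; [exact: Ck_onS|exact: gn|exact: Ck_onS|exact: fn].
Qed.

Lemma Ck_onZ D n c f : open D -> Ck_on D n f -> Ck_on D n (fun x => c * f x).
Proof. by move=> oD; apply: Ck_onM => //; exact: Ck_on_cst. Qed.

Lemma Ck_onN D n f : open D -> Ck_on D n f -> Ck_on D n (fun x => - f x).
Proof.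
move=> oD /(Ck_onZ (-1) oD); congr Ck_on.
by apply/funext => x; rewrite mulN1r.
Qed.

Lemma Ck_on_sum D n (I : finType) (F : I -> V -> R) : open D ->
  (forall i, Ck_on D n (F i)) -> Ck_on D n (fun x => \sum_i F i x).
Proof.
move=> oD Fn; elim: (index_enum I) => [|i s IH].
  by under eq_fun do rewrite big_nil; exact: Ck_on_cst.
by under eq_fun do rewrite big_cons; exact: Ck_onD.
Qed.

Lemma Ck_on_linear D n (f : {linear V -> R}) : continuous f -> Ck_on D n f.
Proof.
move=> fc; case: n => [x _|n]; first exact: fc.
split=> [x _|v]; first exact: linear_differentiable.
have -> : (fun x => 'D_v f x) = fun=> f v; last exact: Ck_on_cst.
apply/funext => x; rewrite deriveE; last exact: linear_differentiable.
by rewrite diff_lin.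
Qed.
End SmoothOn.

(** * Composition with functions of one variable: inverse, logarithm, square root *)

Section SmoothComposition.
Variable R : realType.

Lemma is_derive_comp1 (V : normedModType R) (f : V -> R) (phi : R -> R) x v c :
  differentiable f x -> is_derive (f x) 1 phi c ->
  differentiable (phi \o f) x /\ 'D_v (phi \o f) x = c * 'D_v f x.
Proof.
move=> df [dphi phic]; have dphi' := (derivable1_diffP _ _).1 dphi.
have dc : differentiable (phi \o f) x by exact: differentiable_comp.
split=> //; rewrite deriveE // (deriveE v df) diff_comp //= deriv1E //.
by rewrite derive1E phic mulrC.
Qed.

(** Induction for all [phi] at once: the derivative along [v] is phi'(f) times that of [f], and the
    induction hypothesis applies to phi'. *)
Lemma Ck_on_comp (V : normedModType R) (D : set V) (E : set R) n
    (f : V -> R) (phi : R -> R) :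
  open D -> open E -> (forall x, D x -> E (f x)) ->
  Ck_on E n phi -> Ck_on D n f -> Ck_on D n (phi \o f).
Proof.
move=> oD oE DE; elim: n f DE phi => [|n IH] f DE phi.
  move=> cphi cf x Dx; apply: continuous_comp; first exact: cf.
  exact/cphi/DE.
move=> [dphi phin] fS; have [df fn] := fS.
have key x v : D x -> differentiable (phi \o f) x /\
    'D_v (phi \o f) x = 'D_1 phi (f x) * 'D_v f x.
  move=> Dx; apply: is_derive_comp1; first exact: df.
  exact/derivableP/diff_derivable/dphi/DE.
split=> [x Dx|v]; first by have [] := key x 0 Dx.
apply: (@eq_Ck_on _ _ _ _ (fun x => 'D_1 phi (f x) * 'D_v f x)) => //.
  by move=> x; rewrite inE => Dx; have [] := key x v Dx.
apply: Ck_onM => //; last exact: fn.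
exact: (IH f DE (fun t => 'D_1 phi t) (phin 1) (Ck_onS fS)).
Qed.

Lemma Ck_on1S (E : set R) n (phi psi : R -> R) : open E ->
  (forall x, E x -> is_derive x 1 phi (psi x)) -> Ck_on E n psi ->
  Ck_on E n.+1 phi.
Proof.
move=> oE dphi psin.
have dE x : E x -> differentiable phi x.
  by move=> Ex; apply/derivable1_diffP; have [] := dphi x Ex.
split=> // v; apply: (@eq_Ck_on _ _ _ _ (fun x => v * psi x)) => //.
  move=> x; rewrite inE => Ex; rewrite deriveE; last exact: dE.
  rewrite deriv1E; last by have [] := dphi x Ex.
  by rewrite /= derive1E; have [_ ->] := dphi x Ex.
exact: Ck_onZ.
Qed.

Let open_gt0 : open [set x : R | 0 < x].
Proof. exact: open_gt. Qed.

Lemma Ck_on_expR (E : set R) n : open E -> Ck_on E n (@expR R).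
Proof.
move=> oE; elim: n => [x _|n IH]; first exact: continuous_expR.
by apply: Ck_on1S IH.
Qed.

Lemma Ck_on_inv n : Ck_on [set x : R | 0 < x] n GRing.inv.
Proof.
have dinv (x : R) : 0 < x -> is_derive x 1 GRing.inv (- (x^-1 * x^-1)).
  move=> x0; have xN0 : x != 0 by rewrite gt_eqF.
  have := @is_deriveV R id x 1 1 xN0 (is_derive_id _ _).
  by rewrite /GRing.scale /= mulr1 expr2 invfM.
elim: n => [x /= x0|n IH].
  by apply/differentiable_continuous/derivable1_diffP; have [] := dinv x x0.
apply: (Ck_on1S (psi := fun x => - (x^-1 * x^-1))) => //.
by apply: Ck_onN => //; exact: Ck_onM.
Qed.

Lemma Ck_on_ln n : Ck_on [set x : R | 0 < x] n (@ln R).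
Proof.
case: n => [x /= x0|n]; first exact: continuous_ln.
by apply: (Ck_on1S (psi := GRing.inv)) (Ck_on_inv n) => // x; exact: is_derive1_ln.
Qed.

Lemma Ck_on_sqrt n : Ck_on [set x : R | 0 < x] n (@Num.sqrt R).
Proof.
elim: n => [x _|n IH]; first exact: sqrt_continuous.
apply: (Ck_on1S (psi := fun x => (2 * Num.sqrt x)^-1)) => //.
have h (x : R) : 0 < x -> 0 < 2 * Num.sqrt x.
  by move=> x0; rewrite mulr_gt0 // sqrtr_gt0.
exact: (Ck_on_comp open_gt0 open_gt0 h (Ck_on_inv n) (Ck_onZ 2 open_gt0 IH)).
Qed.

End SmoothComposition.

(** * The flat function exp(-1/t) *)

Section FlatFunction.
Variable R : realType.

(* [flat 0] is the flat function exp(-1/t); the other [flat n] only occur in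
   its successive derivatives. *)
Definition flat (n : nat) (t : R) : R :=
  if 0 < t then t^-1 ^+ n * expR (- t^-1) else 0.

(** This is exp(s) >= s^(n+1) / (n+1)! at s = 1/t. A bound linear in [t] yields continuity at 0 for
    every [n]. *)
Lemma flat_le n t : 0 < t -> flat n t <= (n.+1)`!%:R * t.
Proof.
move=> t0; rewrite /flat t0 expRN ler_pdivrMr ?expR_gt0 //.
have tV0 : 0 < t^-1 by rewrite invr_gt0.
have := expR_ge1Dxn n (ltW tV0); set f := (n.+1)`!%:R => ef.
have f0 : 0 < f :> R by rewrite ltr0n fact_gt0.
have {}ef : t^-1 ^+ n.+1 / f <= expR t^-1.
  by apply: le_trans ef; rewrite lerDr.
have := ler_wpM2l (ltW (mulr_gt0 f0 t0)) ef; apply: le_trans.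
rewrite exprS le_eqVlt; apply/orP; left; apply/eqP.
by field; rewrite !gt_eqF.
Qed.

Lemma flat_continuous0 n : {for 0, continuous (flat n)}.
Proof.
apply/cvgrPdist_le => e e0; rewrite /flat ltxx.
have f0 : 0 < (n.+1)`!%:R :> R by rewrite ltr0n fact_gt0.
near=> t; rewrite sub0r normrN.
case: ifPn => t0; last by rewrite normr0 ltW.
rewrite ger0_norm ?mulr_ge0 ?exprn_ge0 ?invr_ge0 ?expR_ge0 ?(ltW t0) //.
have := flat_le n t0; rewrite /flat t0 => /le_trans; apply.
rewrite -ler_pdivlMl // mulrC; apply: le_trans (ler_norm _) _.
near: t; apply/nbhs_normP; exists (e / (n.+1)`!%:R) => /=.
  by rewrite divr_gt0.
by move=> t /=; rewrite sub0r normrN => /ltW.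
Unshelve. all: by end_near. Qed.

(** The derivative stays in the linear span of the family, so smoothness of all [flat n] follows by
    one induction. *)
Lemma is_derive_flat n (t : R) :
  is_derive t (1 : R) (flat n) (flat n.+2 t - n%:R * flat n.+1 t).
Proof.
have [t0|t0|<-] := ltgtP 0 t.
- apply: (@near_eq_is_derive _ R R (fun s => s^-1 ^+ n * expR (- s^-1))).
    near=> s; rewrite /flat ifT //; near: s; exact: lt_nbhsr.
  have tN0 : t != 0 by rewrite gt_eqF.
  have dV := @is_deriveV R id t 1 1 tN0 (is_derive_id _ _).
  rewrite /flat t0.
  have dE : is_derive t 1 (fun s : R => expR (- s^-1)) (expR (- t^-1) * (t^-1 ^+ 2)).
    apply: (@is_derive1_comp _ expR (fun s => - s^-1)).
    apply: is_derive_eq; rewrite /GRing.scale /= mulr1 opprK exprVn //.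
  have dX : is_derive t 1 (fun s : R => s^-1 ^+ n)
      ((n%:R * t^-1 ^+ n.-1) * - t^-1 ^+ 2).
    have := is_deriveX n dV.
    by rewrite exprfctE /GRing.scale /= mulr1 !exprVn.
  apply: (is_derive_eq (is_deriveM dX dE)); rewrite /GRing.scale /=.
  case: n {dX} => [|n]; first by rewrite !expr0; ring.
  by rewrite !exprS; ring.
- apply: (@near_eq_is_derive _ R R (cst 0)).
    near=> s; rewrite /flat ifF //; apply/negbTE; rewrite -leNgt ltW //.
    near: s; exact: lt_nbhsl.
  by apply: is_derive_eq; rewrite /flat ltNge (ltW t0) /= mulr0 subr0.
(* At 0 the difference quotient of [flat n] is [flat n.+1], which is continuous there with value
   0. *)
- apply/is_derive1_caratheodory; exists (flat n.+1); split.
  + move=> z; rewrite /flat ltxx !subr0; case: ifPn => z0; last by rewrite mul0r.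
    by rewrite exprS; field; rewrite gt_eqF.
  + exact: flat_continuous0.
  + by rewrite /flat ltxx mulr0 subr0.
Unshelve. all: by end_near. Qed.

Lemma Ck_on_flat D k n : open D -> Ck_on D k (flat n).
Proof.
move=> oD; elim: k n => [|k IH] n.
  move=> x _; apply/differentiable_continuous/derivable1_diffP.
  by have [] := is_derive_flat n x.
apply: Ck_on1S (fun x _ => is_derive_flat n x) _ => //.
by apply: Ck_onD => //; apply/Ck_onN/Ck_onZ => //; exact: IH.
Qed.

End FlatFunction.

(** * Three by three matrices and the Lie algebra of SO(2,1) *)

Section ThreeByThree.

Definition i0 : 'I_3 := @Ordinal 3 0 isT.
Definition i1 : 'I_3 := @Ordinal 3 1 isT.
Definition i2 : 'I_3 := @Ordinal 3 2 isT.

Lemma ord3P (P : 'I_3 -> Prop) : P i0 -> P i1 -> P i2 -> forall i, P i.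
Proof.
move=> P0 P1 P2 [[|[|[|//]]] lti].
- by rewrite (_ : Ordinal lti = i0) //; exact: val_inj.
- by rewrite (_ : Ordinal lti = i1) //; exact: val_inj.
- by rewrite (_ : Ordinal lti = i2) //; exact: val_inj.
Qed.

Lemma sum3 (V : nmodType) (F : 'I_3 -> V) : \sum_i F i = F i0 + F i1 + F i2.
Proof.
rewrite !big_ord_recr big_ord0 /= add0r.
by congr (F _ + F _ + F _); exact: val_inj.
Qed.

Variable K : comUnitRingType.
Implicit Types (A h : 'M[K]_3) (w : 'cV[K]_3).

Lemma det3E A : \det A =
  A i0 i0 * (A i1 i1 * A i2 i2 - A i1 i2 * A i2 i1)
  - A i0 i1 * (A i1 i0 * A i2 i2 - A i1 i2 * A i2 i0)
  + A i0 i2 * (A i1 i0 * A i2 i1 - A i1 i1 * A i2 i0).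
Proof.
(* Indexing by natural numbers lets the lifted ordinals of the cofactor expansions compute. *)
pose B i j := A (inord i) (inord j).
have AE (i j : 'I_3) : A i j = B i j by rewrite /B !inord_val.
rewrite (expand_det_row _ i0) sum3 /cofactor.
do ![rewrite (expand_det_row _ ord0) !big_ord_recl big_ord0 /cofactor
     | rewrite det_mx11].
rewrite !mxE !AE !det_mx00 /= /bump /= !(add0n, addn0, add1n); ring.
Qed.

Lemma mulmx3E m p (A : 'M[K]_(m, 3)) (B : 'M[K]_(3, p)) i j :
  (A *m B) i j = A i i0 * B i0 j + A i i1 * B i1 j + A i i2 * B i2 j.
Proof. by rewrite mxE sum3. Qed.

Lemma tr3E A : \tr A = A i0 i0 + A i1 i1 + A i2 i2.
Proof. exact: sum3. Qed.

Lemma I21E i j :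
  I21 K i j = if i == j then (if i == i2 then -1 else 1) else 0.
Proof.
rewrite !mxE (_ : ord_max = i2); last exact: val_inj.
by have [->|_] := eqVneq i j; rewrite ?mulr1n ?mulr0n.
Qed.

Definition col3 (a b c : K) : 'cV[K]_3 :=
  \col_i (if i == i0 then a else if i == i1 then b else c).

(** The matrix of the Euclidean cross product with [w] on the left. *)
Definition cross w : 'M[K]_3 := \matrix_(i, j)
  match val i, val j with
  | 0%N, 1%N => - w i2 0 | 0%N, 2%N => w i1 0
  | 1%N, 0%N => w i2 0   | 1%N, 2%N => - w i0 0
  | 2%N, 0%N => - w i1 0 | 2%N, 1%N => w i0 0
  | _, _ => 0
  end.

(* The isomorphism from R^{2,1} to the Lie algebra of SO(2,1). *)
Definition hat w : 'M[K]_3 := I21 K *m cross w.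

(** Matrix form of det(h u, h w, h v) = det h det(u, w, v). *)
Lemma cross_mul h w : h^T *m cross (h *m w) *m h = \det h *: cross w.
Proof.
rewrite det3E; apply/matrixP; apply: ord3P; apply: ord3P;
  rewrite !(mulmx3E, mxE) /= ?(mulmx3E, mxE); ring.
Qed.

Lemma hatE w : hat w = \matrix_(i, j)
  match val i, val j with
  | 0%N, 1%N => - w i2 0 | 0%N, 2%N => w i1 0
  | 1%N, 0%N => w i2 0   | 1%N, 2%N => - w i0 0
  | 2%N, 0%N => w i1 0 | 2%N, 1%N => - w i0 0
  | _, _ => 0
  end.
Proof.
apply/matrixP; apply: ord3P; apply: ord3P;
  rewrite mulmx3E !I21E !mxE /=; ring.
Qed.

(** By [cross_mul], [cross] transforms by the inverse transpose of [h] on the left; [sigma h = h]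
    carries this factor across [I21] and turns it into [h]. *)
Lemma hat_mul h w : \det h = 1 -> sigma h = h ->
  hat (h *m w) = h *m hat w *m invmx h.
Proof.
move=> dh sh; have uh : h \in unitmx by rewrite unitmxE dh unitr1.
have crE : cross (h *m w) = (invmx h)^T *m cross w *m invmx h.
  have := cross_mul h w; rewrite dh scale1r => <-.
  by rewrite !mulmxA -trmx_mul mulmxV // trmx1 mul1mx mulmxK.
rewrite -{2}sh /sigma /hat crE !mulmxA; congr (_ *m _ *m _).
by rewrite -(mulmxA _ (I21 K)) I21K mulmx1.
Qed.

Lemma qpred3P A : A \in @qpred K <->
  [/\ A i1 i0 = A i0 i1, A i2 i0 = - A i0 i2, A i2 i1 = - A i1 i2 &
      A i2 i2 = - A i0 i0 - A i1 i1].
Proof.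
split=> [/andP[/eqP hA /eqP tA]|[h10 h20 h21 h22]].
  have E i j := congr1 (fun B : 'M[K]_3 => B i j) hA.
  move: (E i1 i0) (E i2 i0) (E i2 i1) tA.
  rewrite !mulmx3E !I21E !mxE /= tr3E.
  rewrite !(mul0r, mulr0, mul1r, mulr1, mulN1r, mulrN1, add0r, addr0).
  move=> -> <- <- tA; split=> //.
  by rewrite -[RHS]addr0 -tA; ring.
apply/andP; split; last by rewrite tr3E h22; apply/eqP; ring.
apply/eqP/matrixP; apply: ord3P; apply: ord3P;
  rewrite !mulmx3E !I21E !mxE /= ?h10 ?h20 ?h21 ?h22; ring.
Qed.

(** The bracket relation of the symmetric pair: the Lie algebra of H maps q to q. *)
Lemma hat_comm_qpred w A : A \in @qpred K -> hat w *m A - A *m hat w \in @qpred K.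
Proof.
move=> /qpred3P[h10 h20 h21 h22]; apply/qpred3P.
rewrite hatE; split; rewrite !(mulmx3E, mxE) /= ?h10 ?h20 ?h21 ?h22; ring.
Qed.

End ThreeByThree.

(** * The real eigenvector *)

Section Cubic.
Variable R : realType.
Implicit Types (x h : 'M[R]_3) (t : 'cV[R]_3) (p q l : R).

(* Cardano's formula; for [0 < p] the cube root is that of a positive number. *)
Definition cardano_base p q : R := - (q / 2) + Num.sqrt (q ^+ 2 / 4 + p ^+ 3 / 27).

Definition cardano p q : R :=
  let z := expR (ln (cardano_base p q) / 3) in z - p / (3 * z).

Lemma cardano_disc_gt0 p q : 0 < p -> 0 < q ^+ 2 / 4 + p ^+ 3 / 27.
Proof.
move=> p0; rewrite ltr_wpDl ?divr_ge0 ?sqr_ge0 //.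
by rewrite divr_gt0 ?exprn_gt0.
Qed.

(** The square root exceeds |q/2|, because p^3/27 is positive. *)
Lemma cardano_base_gt0 p q : 0 < p -> 0 < cardano_base p q.
Proof.
move=> p0; rewrite /cardano_base addrC subr_gt0.
have [q0|q0] := leP (q / 2) 0.
  by rewrite (le_lt_trans q0) // sqrtr_gt0 cardano_disc_gt0.
rewrite -[X in X < _]gtr0_norm // -sqrtr_sqr ltr_sqrt ?cardano_disc_gt0 //.
rewrite (_ : (q / 2) ^+ 2 = q ^+ 2 / 4); last by field.
by rewrite ltrDl divr_gt0 ?exprn_gt0.
Qed.

Lemma cardano_root p q : 0 < p -> cardano p q ^+ 3 + p * cardano p q + q = 0.
Proof.
move=> p0; rewrite /cardano; set z := expR _.
have z0 : z != 0 by rewrite gt_eqF ?expR_gt0.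
have zE : z ^+ 3 = cardano_base p q.
  rewrite /z -expRM_natl mulrC divfK ?pnatr_eq0 // lnK //.
  by rewrite posrE cardano_base_gt0.
have sE : (z ^+ 3 + q / 2) ^+ 2 = q ^+ 2 / 4 + p ^+ 3 / 27.
  by rewrite zE /cardano_base addrC addNKr sqr_sqrtr // ltW ?cardano_disc_gt0.
(* Cardano's substitution leaves the resolvent quadratic in [z ^+ 3], divided by [z ^+ 3]. *)
have -> : (z - p / (3 * z)) ^+ 3 + p * (z - p / (3 * z)) + q =
   ((z ^+ 3 + q / 2) ^+ 2 - (q ^+ 2 / 4 + p ^+ 3 / 27)) / z ^+ 3.
  by field; rewrite z0.
by rewrite sE subrr mul0r.
Qed.

(** For traceless [x], these are the coefficients of the characteristic polynomial l^3 + [inv2 x] l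
    + [inv3 x]; as traces they are visibly invariant under conjugation. *)
Definition inv2 x : R := - (\tr (x *m x) / 2).
Definition inv3 x : R := - (\tr (x *m x *m x) / 3).

(* For a traceless [x], the adjugate of [x - l]. *)
Definition adjl x l : 'M[R]_3 := x *m x + l *: x + (l ^+ 2 + inv2 x)%:M.

(* The cross product of [t] and [x t] for the form [I21]. *)
Definition uvec x t : 'cV[R]_3 := hat t *m x *m t.

Definition e3 : 'cV[R]_3 := col3 0 0 1.

(** At an eigenvalue [l] with eigenvector v this is, up to a factor depending on x, det(v, s, x s)
    det(v, t, x t): it compares the directions of v selected by [s] and by [t]. *)
Definition Bform x l s t : R :=
  ((uvec x s)^T *m I21 R *m (adjl x l *m uvec x t)) 0 0.

Definition is_root x l := l ^+ 3 + inv2 x * l + inv3 x = 0.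


Section Coordinates.
Variables (x : 'M[R]_3) (l : R).
Hypothesis qx : x \in @qpred R.
Let a := x i0 i0. Let b := x i0 i1. Let c := x i1 i1.
Let d := x i0 i2. Let e := x i1 i2.

Let x10 : x i1 i0 = b. Proof. by have /qpred3P[] := qx. Qed.
Let x20 : x i2 i0 = - d. Proof. by have /qpred3P[] := qx. Qed.
Let x21 : x i2 i1 = - e. Proof. by have /qpred3P[] := qx. Qed.
Let x22 : x i2 i2 = - a - c. Proof. by have /qpred3P[] := qx. Qed.
Let xE := (x10, x20, x21, x22).

Lemma inv2E : inv2 x = d ^+ 2 + e ^+ 2 - a ^+ 2 - b ^+ 2 - c ^+ 2 - a * c.
Proof.
by rewrite /inv2 tr3E !mulmx3E !xE -/a -/b -/c -/d -/e; field.
Qed.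

Lemma inv3E : inv3 x =
  a * (c * (a + c) - e ^+ 2) - b * (b * (a + c) - e * d) + d * (b * e - c * d).
Proof.
by rewrite /inv3 tr3E !mulmx3E !xE -/a -/b -/c -/d -/e; field.
Qed.

Lemma adjlE i j : adjl x l i j =
  x i i0 * x i0 j + x i i1 * x i1 j + x i i2 * x i2 j + l * x i j +
  (if i == j then l ^+ 2 + inv2 x else 0).
Proof. by rewrite !mxE sum3; case: eqVneq. Qed.

(* The 2x2 minors of the adjugate of [M = x - l] are the entries of [M],
   up to sign, times [\det M = 0]. *)
Lemma adjl_rank1 i j k m : is_root x l ->
  adjl x l i j * adjl x l k m = adjl x l i m * adjl x l k j.
Proof.
rewrite /is_root inv2E inv3E => root_l.
(* Exchanging the rows or the columns of a minor changes only its sign, so nine minors suffice. *)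
pose P i k j m := adjl x l i j * adjl x l k m = adjl x l i m * adjl x l k j.
suff: P i k j m by [].
have cols i' k' : P i' k' i0 i1 -> P i' k' i0 i2 -> P i' k' i1 i2 ->
    forall j' m', P i' k' j' m'.
  by move=> h01 h02 h12; apply: ord3P; apply: ord3P; rewrite /P //; exact/esym.
have rows j' m' : P i0 i1 j' m' -> P i0 i2 j' m' -> P i1 i2 j' m' ->
    forall i' k', P i' k' j' m'.
  by move=> h01 h02 h12; apply: ord3P; apply: ord3P; rewrite /P // mulrC // [RHS]mulrC.
have minor f X Y : X = Y + f *
  (l ^+ 3 + (d ^+ 2 + e ^+ 2 - a ^+ 2 - b ^+ 2 - c ^+ 2 - a * c) * l +
  (a * (c * (a + c) - e ^+ 2) - b * (b * (a + c) - e * d) +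
   d * (b * e - c * d))) -> X = Y by rewrite root_l mulr0 addr0.
apply: cols; apply: rows; rewrite /P.
all: rewrite !adjlE ?xE ?inv2E -/a -/b -/c -/d -/e /=.
- apply: (minor (a + c + l)); ring.
- apply: (minor (- e)); ring.
- apply: (minor (d)); ring.
- apply: (minor (e)); ring.
- apply: (minor (l - c)); ring.
- apply: (minor (b)); ring.
- apply: (minor (- d)); ring.
- apply: (minor (b)); ring.
- apply: (minor (l - a)); ring.
Qed.

(** The right-hand side is a quadratic form in [a1], [a2] of discriminant -3 l^2 - 4 [inv2 x], which
    is also that of the quadratic cofactor of T - l in the characteristic polynomial. For
    [0 < inv2 x] the form is positive definite, whence the sign of [Bform]. *)
Lemma Bform_e3E t : is_root x l ->
  let M := x - l%:M in
  let a1 := (M *m t) i2 0 in let a2 := (M *m (M *m t)) i2 0 in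
  Bform x l e3 t = a2 ^+ 2 + 3 * l * a1 * a2 + (3 * l ^+ 2 + inv2 x) * a1 ^+ 2.
Proof.
move=> + M a1 a2; rewrite /is_root inv3E => root_l.
have a1E : a1 = - d * t i0 0 - e * t i1 0 - (a + c + l) * t i2 0.
  rewrite /a1 /M mulmx3E !mxE !xE /=; ring.
pose y := M *m t.
have y0 : y i0 0 = (a - l) * t i0 0 + b * t i1 0 + d * t i2 0.
  rewrite /y /M mulmx3E !mxE -/a -/b -/d /=; ring.
have y1 : y i1 0 = b * t i0 0 + (c - l) * t i1 0 + e * t i2 0.
  rewrite /y /M mulmx3E !mxE !xE -/c -/e /=; ring.
have y2 : y i2 0 = a1 by [].
have a2E : a2 = - d * y i0 0 - e * y i1 0 - (a + c + l) * a1.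
  rewrite /a2 -/y mulmx3E y2 !mxE !xE /=; ring.
(* Since [hat t] kills [t], the vector x t may be replaced by (x - l) t. *)
have uE : uvec x t = hat t *m y.
  rewrite /y /M mulmxBl mulmxBr mul_scalar_mx -scalemxAr /uvec -mulmxA.
  rewrite (_ : hat t *m t = 0) ?scaler0 ?subr0 //.
  by apply/matrixP; apply: ord3P => j; rewrite hatE !(mulmx3E, mxE) /= ord1; ring.
have u0 : uvec x t i0 0 = t i1 0 * a1 - t i2 0 * y i1 0.
  rewrite uE hatE mulmx3E y2 !mxE /=; ring.
have u1 : uvec x t i1 0 = t i2 0 * y i0 0 - t i0 0 * a1.
  rewrite uE hatE mulmx3E y2 !mxE /=; ring.
have u2 : uvec x t i2 0 = t i1 0 * y i0 0 - t i0 0 * y i1 0.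
  rewrite uE hatE mulmx3E y2 !mxE /=; ring.
have s0 : uvec x e3 i0 0 = - e.
  by rewrite /uvec -mulmxA mulmx3E hatE /e3 /col3 !(mulmx3E, mxE) /= -/d -/e; ring.
have s1 : uvec x e3 i1 0 = d.
  by rewrite /uvec -mulmxA mulmx3E hatE /e3 /col3 !(mulmx3E, mxE) /= -/d -/e; ring.
have s2 : uvec x e3 i2 0 = 0.
  by rewrite /uvec -mulmxA mulmx3E hatE /e3 /col3 !(mulmx3E, mxE) /= -/d -/e; ring.
(* The two sides differ by [a1 * t i2 0] times the characteristic polynomial at [l]. *)
rewrite -[RHS]addr0 -(mulr0 (a1 * t i2 0)) -root_l.
rewrite /Bform mulmx3E !(mulmx3E (_^T)) !I21E /=.
rewrite ![_^T _ _]mxE s0 s1 s2 !(mulmx3E (adjl x l)) u0 u1 u2 !adjlE !xE /=.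
rewrite a2E y0 y1 a1E inv2E -/a -/b -/c -/d -/e.
move: a b c d e (t i0 0) (t i1 0) (t i2 0) => a' b' c' d' e' t0 t1 t2.
ring.
Qed.


(** By completing the square, failure would force [a1 = a2 = 0], hence [d = e = 0]; then [x] is a
    symmetric matrix and [inv2 x] cannot be positive. *)
Lemma Bform_e3_gt0 : 0 < inv2 x -> is_root x l -> 0 < Bform x l e3 e3.
Proof.
move=> p0 root_l; rewrite Bform_e3E //.
set a1 := (_ *m e3) i2 0; set a2 := (_ *m (_ *m _)) i2 0.
have a1E : a1 = - (a + c + l).
  rewrite /a1 mulmx3E /e3 /col3 !mxE !xE /=; ring.
have a2E : a2 = (a + c + l) ^+ 2 - d ^+ 2 - e ^+ 2.
  rewrite /a2 mulmx3E (mulmx3E _ e3) (mulmx3E _ e3) (mulmx3E _ e3).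
  rewrite /e3 /col3 !mxE !xE -/a -/b -/c -/d -/e /=; ring.
have -> : a2 ^+ 2 + 3 * l * a1 * a2 + (3 * l ^+ 2 + inv2 x) * a1 ^+ 2 =
  (a2 + 3 / 2 * l * a1) ^+ 2 + (3 / 4 * l ^+ 2 + inv2 x) * a1 ^+ 2 by field.
have k0 : 0 < 3 / 4 * l ^+ 2 + inv2 x.
  by rewrite ltr_wpDl // mulr_ge0 ?divr_ge0 ?sqr_ge0.
have [z|nz] := eqVneq a1 0; last first.
  rewrite ltr_wpDl ?sqr_ge0 // mulr_gt0 // exprn_even_gt0 //.
rewrite z expr0n /= !mulr0 !addr0 exprn_even_gt0 //=.
apply/eqP => a20; move: p0; apply/negP; rewrite -leNgt inv2E.
have z1 : a + c + l = 0 by rewrite -[LHS]opprK -a1E z oppr0.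
have {a20}de0 : d ^+ 2 + e ^+ 2 = 0.
  by rewrite -[RHS]oppr0 -a20 a2E z1; ring.
have -> : d ^+ 2 + e ^+ 2 - a ^+ 2 - b ^+ 2 - c ^+ 2 - a * c =
  - ((a + c / 2) ^+ 2 + b ^+ 2 + 3 / 4 * c ^+ 2) by rewrite de0; field.
by rewrite oppr_le0 !addr_ge0 ?sqr_ge0 // mulr_ge0 ?sqr_ge0 ?divr_ge0.
Qed.

End Coordinates.

Lemma Bform_e3_ge0 x l t : x \in @qpred R -> 0 < inv2 x -> is_root x l ->
  0 <= Bform x l e3 t.
Proof.
move=> qx p0 root_l; rewrite Bform_e3E //.
set a1 := (_ *m t) i2 0; set a2 := (_ *m (_ *m _)) i2 0.
have -> : a2 ^+ 2 + 3 * l * a1 * a2 + (3 * l ^+ 2 + inv2 x) * a1 ^+ 2 =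
  (a2 + 3 / 2 * l * a1) ^+ 2 + (3 / 4 * l ^+ 2 + inv2 x) * a1 ^+ 2 by field.
rewrite addr_ge0 ?sqr_ge0 // mulr_ge0 ?sqr_ge0 //.
by rewrite addr_ge0 ?(ltW p0) // mulr_ge0 ?divr_ge0 ?sqr_ge0.
Qed.

(** For A = u phi, with u a column and phi a row, both sides are phi(y) phi(z) (r u) u. *)
Lemma rank1_exchange (A : 'M[R]_3) (r : 'rV[R]_3) (y z : 'cV[R]_3) :
  (forall i j k m, A i j * A k m = A i m * A k j) ->
  (r *m (A *m z)) 0 0 *: (A *m y) = (r *m (A *m y)) 0 0 *: (A *m z).
Proof.
move=> rk1; apply/matrixP => i j; rewrite ord1 !mxE {j}.
rewrite !mulr_suml; apply: eq_bigr => k _; rewrite !mxE -!mulrA; congr (_ * _).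
rewrite !big_distrlr /= [RHS]exchange_big /=.
apply: eq_bigr => m _; apply: eq_bigr => j _.
by rewrite mulrACA rk1 [RHS]mulrACA [z m 0 * _]mulrC.
Qed.

End Cubic.

(** * The normalised eigenvector and its equivariance *)

Section EquivariantField.
Variable R : realType.
Implicit Types (x h A : 'M[R]_3) (s t w : 'cV[R]_3).

Definition lam x : R := cardano (inv2 x) (inv3 x).

Definition Avec x : 'cV[R]_3 := adjl x (lam x) *m uvec x (e3 R).

Definition Bnorm x : R := Bform x (lam x) (e3 R) (e3 R).

(* Where [inv2 x > 0], the matrix x has a unique real eigenvalue, [lam x], and
   [adjl x (lam x)] is a multiple of the projection to its eigenline; so
   [Avec x], normalised, is an eigenvector, and any other timelike vector in
   place of [e3] would give the same one. *)
Definition Xmx x : 'M[R]_3 :=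
  (flat 0 (inv2 x - 2^-1) / Num.sqrt (Bnorm x)) *:
  (hat (Avec x) *m x - x *m hat (Avec x)).

Lemma hatZ c w : hat (c *: w) = c *: hat w.
Proof.
by rewrite !hatE; apply/matrixP; apply: ord3P; apply: ord3P;
  rewrite !mxE /=; ring.
Qed.

Lemma lam_root x : 0 < inv2 x -> is_root x (lam x).
Proof. exact: cardano_root. Qed.

(** [x] is self-adjoint for the form [I21], and so is every polynomial in [x]. *)
Lemma adjl_sym x l : x \in @qpred R ->
  (adjl x l)^T *m I21 R = I21 R *m adjl x l.
Proof.
move=> /andP[/eqP sx _].
have xI : x^T *m I21 R = I21 R *m x.
  by rewrite -[in RHS]sx !mulmxA I21K mul1mx.
rewrite /adjl !raddfD /= !linearZ /= !tr_scalar_mx trmx_mul.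
rewrite !mulmxDl -scalemxAl xI -mulmxA xI mulmxA xI -mulmxA.
by rewrite !mul_scalar_mx !mul_mx_scalar.
Qed.

Lemma BformC x l s t : x \in @qpred R -> Bform x l s t = Bform x l t s.
Proof.
move=> qx; rewrite /Bform; move: (uvec x s) (uvec x t) => us ut.
transitivity ((us^T *m I21 R *m (adjl x l *m ut))^T 0 0); first by rewrite [RHS]mxE.
rewrite !trmx_mul trmxK trI21 -!mulmxA (mulmxA (adjl x l)^T) adjl_sym //.
by rewrite !mulmxA.
Qed.

Section Isometry.
Variables (h : 'M[R]_3).
Hypotheses (dh : \det h = 1) (sh : sigma h = h).

Let uh : h \in unitmx. Proof. by rewrite unitmxE dh unitr1. Qed.

Lemma conj_mul A B :
  (h *m A *m invmx h) *m (h *m B *m invmx h) = h *m (A *m B) *m invmx h.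
Proof. by rewrite !mulmxA mulmxKV. Qed.

Lemma conj_tr A : \tr (h *m A *m invmx h) = \tr A.
Proof. by rewrite mxtrace_mulC mulmxA mulVmx // mul1mx. Qed.

Lemma inv2_conj x : inv2 (h *m x *m invmx h) = inv2 x.
Proof. by rewrite /inv2 conj_mul conj_tr. Qed.

Lemma inv3_conj x : inv3 (h *m x *m invmx h) = inv3 x.
Proof. by rewrite /inv3 !conj_mul conj_tr. Qed.

Lemma lam_conj x : lam (h *m x *m invmx h) = lam x.
Proof. by rewrite /lam inv2_conj inv3_conj. Qed.

Lemma adjl_conj x l : adjl (h *m x *m invmx h) l = h *m adjl x l *m invmx h.
Proof.
rewrite /adjl inv2_conj conj_mul !mulmxDr !mulmxDl -scalemxAr -scalemxAl.
by rewrite mul_mx_scalar -scalemxAl mulmxV // scalemx1.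
Qed.

Lemma uvec_conj x t : uvec (h *m x *m invmx h) (h *m t) = h *m uvec x t.
Proof.
by rewrite /uvec hat_mul // conj_mul -!mulmxA (mulmxA (invmx h)) mulVmx // mul1mx.
Qed.

Lemma isometry_I21 : h^T *m I21 R *m h = I21 R.
Proof.
have : h^T *m I21 R *m sigma h = I21 R.
  rewrite /sigma !mulmxA -(mulmxA _ (I21 R) (I21 R)) I21K mulmx1 -trmx_mul.
  by rewrite mulVmx // trmx1 mul1mx.
by rewrite sh.
Qed.

Lemma Bform_conj x l s t :
  Bform (h *m x *m invmx h) l (h *m s) (h *m t) = Bform x l s t.
Proof.
rewrite /Bform !uvec_conj adjl_conj trmx_mul -!mulmxA (mulmxA (invmx h)).
rewrite mulVmx // mul1mx (mulmxA (I21 R)) (mulmxA h^T) (mulmxA h^T).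
by rewrite isometry_I21 !mulmxA.
Qed.

(** Conjugation by [h] amounts to replacing [e3] by [t], its preimage under [h]. Rank one makes the
    two eigenvectors proportional, and the sign of [Bform] makes the factor positive, so they agree
    after normalisation. *)
Lemma Xmx_conj x : x \in @qpred R ->
  Xmx (h *m x *m invmx h) = h *m Xmx x *m invmx h.
Proof.
move=> qx; have qx' : h *m x *m invmx h \in @qpred R.
  exact: (@qconj_subproof _ h (QSpace qx)).
rewrite /Xmx inv2_conj.
(* Where the cutoff vanishes, [lam x] need not be an eigenvalue, but both sides are 0. *)
have [p0|p0] := ltP 0 (inv2 x - 2^-1); last first.
  by rewrite /flat ltNge p0 /= !mul0r !scale0r mulmx0 mul0mx.
have {}p0 : 0 < inv2 x by rewrite (lt_trans _ (_ : 2^-1 < _)) // -subr_gt0.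
have root_l := lam_root p0.
set l := lam x in root_l; set A := adjl x l.
pose t := invmx h *m e3 R; have et : e3 R = h *m t by rewrite mulKVmx.
set ue := uvec x (e3 R); set ut := uvec x t.
have AvE : Avec (h *m x *m invmx h) = h *m (A *m ut).
  by rewrite /Avec lam_conj adjl_conj {1}et uvec_conj -mulmxA mulKmx // mulmxA.
have n'E : Bnorm (h *m x *m invmx h) = Bform x l t t.
  by rewrite /Bnorm lam_conj et Bform_conj.
set n := Bform x l (e3 R) (e3 R); set b := Bform x l (e3 R) t.
have n0 : 0 < n by exact: Bform_e3_gt0.
have n'0 : 0 < Bform x l t t.
  rewrite -n'E /Bnorm lam_conj; apply: Bform_e3_gt0; rewrite ?inv2_conj //.
  by rewrite /is_root inv2_conj inv3_conj.
have b0 : 0 <= b by exact: Bform_e3_ge0.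
have rk1 i j k m := @adjl_rank1 R x l qx i j k m root_l.
have exch r := @rank1_exchange R A r ue ut rk1.
have bn : b *: (A *m ue) = n *: (A *m ut) by exact: exch.
(* Equality in Cauchy-Schwarz, obtained by pairing [bn] with [ut]. *)
have nn' : n * Bform x l t t = b ^+ 2.
  have := congr1 (fun v => (ut^T *m I21 R *m v) 0 0) bn.
  rewrite -!scalemxAr [LHS]mxE [RHS]mxE => /esym.
  by rewrite -[X in _ = b * X -> _]/(Bform x l t (e3 R)) BformC.
(* Here [0 <= b] selects the sign: without it the eigenvector would be canonical only up to sign. *)
have bE : b = Num.sqrt n * Num.sqrt (Bform x l t t).
  by rewrite -sqrtrM ?ltW // nn' sqrtr_sqr ger0_norm.
have sn0 : Num.sqrt n != 0 by rewrite gt_eqF // sqrtr_gt0.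
have sn'0 : Num.sqrt (Bform x l t t) != 0 by rewrite gt_eqF // sqrtr_gt0.
have nE : n = Num.sqrt n ^+ 2 by rewrite sqr_sqrtr // ltW.
have AutE : A *m ut =
    (Num.sqrt (Bform x l t t) / Num.sqrt n) *: (A *m ue).
  have nN0 : n != 0 by rewrite gt_eqF.
  apply: (scalerI nN0).
  rewrite -bn scalerA; congr (_ *: _); rewrite bE {2}nE.
  by field.
rewrite AvE hat_mul // n'E AutE hatZ !conj_mul -mulmxBl -mulmxBr.
rewrite -!(scalemxAl, scalemxAr) -scalerBr -!(scalemxAl, scalemxAr) scalerA.
by congr (_ *: _); field; rewrite sn0.
Qed.

End Isometry.
End EquivariantField.

(** * Smoothness of the equivariant field *)

Section SmoothField.
Variable R : realType.
Local Notation Q := (qspace R).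
Implicit Types (D : set Q) (n : nat).

Definition qcoord (i j : 'I_3) (x : Q) : R := qmx x i j.

Lemma qcoord_is_linear i j : linear (qcoord i j).
Proof.
move=> a x y; rewrite /qcoord.
have -> : qmx (a *: x + y) = a *: qmx x + qmx y by exact: (linearP (val : Q -> _)).
by rewrite !mxE.
Qed.

HB.instance Definition _ i j :=
  GRing.isLinear.Build R Q R _ (qcoord i j) (qcoord_is_linear i j).

(** The norm of q is induced from the matrices, so [qmx] preserves distances. *)
Lemma qmx_continuous : continuous (@qmx R : Q -> 'M[R]_3).
Proof.
move=> x; have FF : Filter (nbhs x) by exact: nbhs_filter.
apply: (@cvgrPdist_lt _ _ _ (nbhs x) FF (@qmx R) (qmx x)).2 => e e0.
by apply/nbhs_normP; exists e.
Qed.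

Lemma qcoord_continuous i j : continuous (qcoord i j).
Proof.
move=> x; exact: (@continuous_comp Q 'M[R]_3 R (@qmx R) (fun M => M i j) x
  (@qmx_continuous x) (@coord_continuous R 3 3 i j (qmx x))).
Qed.

Definition mx_Ck_on D n m p (F : Q -> 'M[R]_(m, p)) :=
  forall i j, Ck_on D n (fun x => F x i j).

Section Operations.
Variables (D : set Q) (n : nat).
Hypothesis oD : open D.

Lemma mx_Ck_on_qmx : mx_Ck_on D n (fun x => qmx x).
Proof. by move=> i j; exact: (Ck_on_linear D n (@qcoord_continuous i j)). Qed.

Lemma mx_Ck_on_cst m p (A : 'M[R]_(m, p)) : mx_Ck_on D n (fun=> A).
Proof. by move=> i j; exact: Ck_on_cst. Qed.

Lemma mx_Ck_onM m p r (F : Q -> 'M[R]_(m, p)) (G : Q -> 'M[R]_(p, r)) :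
  mx_Ck_on D n F -> mx_Ck_on D n G -> mx_Ck_on D n (fun x => F x *m G x).
Proof.
move=> hF hG i j; under eq_fun do rewrite mxE.
by apply: Ck_on_sum => // k; exact: Ck_onM.
Qed.

Lemma mx_Ck_onD m p (F G : Q -> 'M[R]_(m, p)) :
  mx_Ck_on D n F -> mx_Ck_on D n G -> mx_Ck_on D n (fun x => F x + G x).
Proof.
by move=> hF hG i j; under eq_fun do rewrite mxE; exact: Ck_onD.
Qed.

Lemma mx_Ck_onZ m p (c : Q -> R) (F : Q -> 'M[R]_(m, p)) :
  Ck_on D n c -> mx_Ck_on D n F -> mx_Ck_on D n (fun x => c x *: F x).
Proof.
by move=> hc hF i j; under eq_fun do rewrite mxE; exact: Ck_onM.
Qed.

Lemma mx_Ck_onB m p (F G : Q -> 'M[R]_(m, p)) :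
  mx_Ck_on D n F -> mx_Ck_on D n G -> mx_Ck_on D n (fun x => F x - G x).
Proof.
move=> hF hG i j; under eq_fun do rewrite 2!mxE.
by apply: Ck_onD => //; exact: Ck_onN.
Qed.

Lemma mx_Ck_on_tr m p (F : Q -> 'M[R]_(m, p)) :
  mx_Ck_on D n F -> mx_Ck_on D n (fun x => (F x)^T).
Proof. by move=> hF i j; under eq_fun do rewrite mxE. Qed.

Lemma mx_Ck_on_hat (F : Q -> 'cV[R]_3) :
  mx_Ck_on D n F -> mx_Ck_on D n (fun x => hat (F x)).
Proof.
move=> hF; apply: ord3P; apply: ord3P; under eq_fun do rewrite hatE mxE /=;
  by [exact: Ck_on_cst | exact: hF | exact/Ck_onN/hF].
Qed.

Lemma Ck_on_mxtrace (F : Q -> 'M[R]_3) :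
  mx_Ck_on D n F -> Ck_on D n (fun x => \tr (F x)).
Proof. by move=> hF; exact: Ck_on_sum. Qed.

Lemma Ck_on_inv2 : Ck_on D n (fun x => inv2 (qmx x)).
Proof.
apply: Ck_onN => //; apply: Ck_onM => //; last exact: Ck_on_cst.
by apply: Ck_on_mxtrace; apply: mx_Ck_onM; exact: mx_Ck_on_qmx.
Qed.

Lemma Ck_on_inv3 : Ck_on D n (fun x => inv3 (qmx x)).
Proof.
apply: Ck_onN => //; apply: Ck_onM => //; last exact: Ck_on_cst.
apply: Ck_on_mxtrace; apply: mx_Ck_onM; last exact: mx_Ck_on_qmx.
by apply: mx_Ck_onM; exact: mx_Ck_on_qmx.
Qed.

End Operations.

Definition Dpos : set Q := [set x | 0 < inv2 (qmx x)].
(** An open set on which the cutoff vanishes. The shift by [2^-1] in [Xmx] makes it overlap [Dpos],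
    so that the two cover q. *)
Definition Dneg : set Q := [set x | inv2 (qmx x) < 2^-1].

Lemma inv2_continuous : continuous (fun x : Q => inv2 (qmx x)).
Proof. by move=> x; apply: (Ck_on_inv2 0 (@openT Q)). Qed.

Lemma open_Dpos : open Dpos.
Proof.
have h := (continuousP (fun x : Q => inv2 (qmx x))).1 inv2_continuous.
exact: h (@open_gt R 0).
Qed.

Lemma open_Dneg : open Dneg.
Proof.
have h := (continuousP (fun x : Q => inv2 (qmx x))).1 inv2_continuous.
exact: h (@open_lt R _).
Qed.

Lemma Dpos_neg : Dpos `|` Dneg = setT.
Proof.
apply/seteqP; split=> // x _; have [p0|p0] := ltP 0 (inv2 (qmx x)); [by left|right].
by rewrite /Dneg /= (le_lt_trans p0).
Qed.

Let open_gt0 : open [set t : R | 0 < t].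
Proof. exact: open_gt. Qed.

Lemma Ck_on_posE n (f : Q -> R) (phi : R -> R) :
  (forall k, Ck_on [set t : R | 0 < t] k phi) ->
  (forall x, Dpos x -> 0 < f x) -> Ck_on Dpos n f ->
  Ck_on Dpos n (fun x => phi (f x)).
Proof.
move=> hphi f0 hf; exact: (Ck_on_comp open_Dpos open_gt0 f0 (hphi n) hf).
Qed.

(** On [Dpos] every square root, logarithm and inverse in Cardano's formula is taken at a positive
    number. *)
Lemma Ck_on_lam n : Ck_on Dpos n (fun x => lam (qmx x)).
Proof.
have oD := open_Dpos; have h2 := Ck_on_inv2 n oD; have h3 := Ck_on_inv3 n oD.
have hb : Ck_on Dpos n (fun x => cardano_base (inv2 (qmx x)) (inv3 (qmx x))).
  apply: Ck_onD => //.
    by apply: Ck_onN => //; apply: Ck_onM => //; exact: Ck_on_cst.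
  apply: (Ck_on_posE (@Ck_on_sqrt R)).
    by move=> x Dx; exact: cardano_disc_gt0.
  by apply: Ck_onD => //; apply: Ck_onM => //; do ?[exact: Ck_on_cst];
    do ?[apply: Ck_onM => //].
have hz : Ck_on Dpos n
    (fun x => expR (ln (cardano_base (inv2 (qmx x)) (inv3 (qmx x))) / 3)).
  have hl : Ck_on Dpos n
      (fun x => ln (cardano_base (inv2 (qmx x)) (inv3 (qmx x))) / 3).
    apply: Ck_onM => //; last exact: Ck_on_cst.
    apply: (Ck_on_posE (@Ck_on_ln R)) => //.
    by move=> x Dx; exact: cardano_base_gt0.
  exact: (Ck_on_comp oD (@openT R) (fun _ _ => I) (Ck_on_expR n (@openT R)) hl).
apply: Ck_onD => //; apply: Ck_onN => //; apply: Ck_onM => //.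
apply: (Ck_on_posE (@Ck_on_inv R)); last exact: Ck_onZ.
by move=> x Dx; rewrite mulr_gt0 ?expR_gt0.
Qed.

Lemma mx_Ck_on_uvec D n : open D -> mx_Ck_on D n (fun x => uvec (qmx x) (e3 R)).
Proof.
move=> oD; apply: mx_Ck_onM => //; last exact: mx_Ck_on_cst.
by apply: mx_Ck_onM => //; [exact: mx_Ck_on_cst|exact: mx_Ck_on_qmx].
Qed.

Lemma mx_Ck_on_Avec n : mx_Ck_on Dpos n (fun x => Avec (qmx x)).
Proof.
have oD := open_Dpos; have hl := Ck_on_lam n.
apply: mx_Ck_onM => //; last exact: mx_Ck_on_uvec.
have hx : mx_Ck_on Dpos n (fun x => qmx x) by exact: mx_Ck_on_qmx.
apply: mx_Ck_onD => //.
  by apply: mx_Ck_onD => //; [exact: mx_Ck_onM|exact: mx_Ck_onZ].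
move=> i j; under eq_fun do rewrite mxE -mulr_natr.
apply: Ck_onM => //; last exact: Ck_on_cst.
by apply: Ck_onD => //; [exact: Ck_onM|exact: Ck_on_inv2].
Qed.

Lemma Ck_on_Bnorm n : Ck_on Dpos n (fun x => Bnorm (qmx x)).
Proof.
have oD := open_Dpos.
suff : mx_Ck_on Dpos n
  (fun x => (uvec (qmx x) (e3 R))^T *m I21 R *m Avec (qmx x)) by exact.
apply: mx_Ck_onM => //; last exact: mx_Ck_on_Avec.
apply: mx_Ck_onM => //; last exact: mx_Ck_on_cst.
exact/mx_Ck_on_tr/mx_Ck_on_uvec.
Qed.

Lemma Bnorm_gt0 (x : Q) : Dpos x -> 0 < Bnorm (qmx x).
Proof.
move=> Dx; apply: Bform_e3_gt0 => //; [exact: valP | exact: lam_root].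
Qed.

Lemma Xmx_smooth i j : smooth (fun x : Q => Xmx (qmx x) i j).
Proof.
move=> n; apply: Ck_onT; rewrite -Dpos_neg; apply: Ck_onU; last first.
  apply: (eq_Ck_on open_Dneg) (Ck_on_cst Dneg n 0) => x; rewrite inE => Dx.
  rewrite mxE /flat ifF ?mul0r //.
  by apply/negbTE; rewrite -leNgt subr_le0 ltW.
have oD := open_Dpos; have hx : mx_Ck_on Dpos n (fun x => qmx x).
  exact: mx_Ck_on_qmx.
have hA := mx_Ck_on_hat oD (@mx_Ck_on_Avec n).
apply: mx_Ck_onZ => //; last by apply: mx_Ck_onB => //; exact: mx_Ck_onM.
apply: Ck_onM => //.
  have hi : Ck_on Dpos n (fun x => inv2 (qmx x) - 2^-1).
    by apply: Ck_onD => //; [exact: Ck_on_inv2|exact: Ck_on_cst].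
  exact: (Ck_on_comp oD (@openT R) (fun _ _ => I) (Ck_on_flat n 0 (@openT R)) hi).
apply: (Ck_on_posE (@Ck_on_inv R)).
  by move=> x Dx; rewrite sqrtr_gt0 Bnorm_gt0.
apply: (Ck_on_posE (@Ck_on_sqrt R)); last exact: Ck_on_Bnorm.
exact: Bnorm_gt0.
Qed.

End SmoothField.

(** * One-parameter subgroups of H and invariant functions *)

Section CurvesInH.
Variable R : realType.
Local Notation Q := (qspace R).
Implicit Types C h : 'M[R]_3.

Section MatrixDerivative.
Variables (V : normedModType R) (t u : V).
Implicit Types (F G : V -> 'M[R]_3) (dF dG : 'M[R]_3).

Definition mx_derive F dF :=
  forall i j, is_derive t u (fun s => F s i j) (dF i j).

Lemma mx_is_derive F dF : mx_derive F dF -> is_derive t u F dF.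
Proof.
move=> hF.
have hd : derivable F t u by apply/derivable_mxP => i j; have [] := hF i j.
split=> //; rewrite derive_mx //; apply/matrixP => i j; rewrite mxE.
by have [] := hF i j.
Qed.

Lemma mx_derive_cst (A : 'M[R]_3) : mx_derive (fun=> A) 0.
Proof. by move=> i j; rewrite mxE; exact: is_derive_cst. Qed.

Lemma mx_deriveM F G dF dG : mx_derive F dF -> mx_derive G dG ->
  mx_derive (fun s => F s *m G s) (dF *m G t + F t *m dG).
Proof.
move=> hF hG i j; rewrite !mxE -big_split /=.
have -> : (fun s => (F s *m G s) i j) = \sum_k (fun s => F s i k * G s k j).
  by apply/funext => s; rewrite mxE fct_sumE.
apply: is_derive_sum => k.
apply: (is_derive_eq (is_deriveM (hF i k) (hG k j))).
by rewrite /GRing.scale /= addrC [G t k j * _]mulrC.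
Qed.

Lemma is_derive_mxtrace F dF : mx_derive F dF ->
  is_derive t u (fun s => \tr (F s)) (\tr dF).
Proof.
move=> hF; have -> : (fun s => \tr (F s)) = \sum_k (fun s => F s k k).
  by apply/funext => s; rewrite fct_sumE.
by apply: is_derive_sum => k; exact: hF.
Qed.

End MatrixDerivative.

(** Since q carries the matrix norm, the limit of the difference quotients can be tested on
    matrices. *)
Lemma is_derive_qspace (k : R -> Q) t (v : Q) :
  is_derive t (1 : R) (fun s => qmx (k s)) (qmx v) -> is_derive t (1 : R) k v.
Proof.
move=> [dk kE].
have cvgM : (fun h : R => h^-1 *: (qmx (k (h *: 1 + t)) - qmx (k t))) @ 0^' --> qmx v.
  by rewrite -kE; exact: dk.
have cvgQ : (fun h : R => h^-1 *: (k (h *: 1 + t) - k t)) @ 0^' --> v.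
  apply/cvgrPdist_lt => e e0.
  by move/cvgrPdist_lt : cvgM => /(_ e e0).
by split; [apply: cvgP cvgQ | apply: cvg_lim cvgQ].
Qed.

(* For [C ^ 3 = e C] with [e = 1] or [e = -1], and (c, s) = (cosh t, sinh t)
   or (cos t, sin t) respectively, this is exp(t C). *)
Definition expC (e : R) C (c s : R) : 'M[R]_3 :=
  1%:M + s *: C + (e * (c - 1)) *: (C *m C).

Lemma mx_derive_expC e C (c s : R -> R) t c' s' :
  is_derive t (1 : R) c c' -> is_derive t (1 : R) s s' ->
  mx_derive t (1 : R) (fun u => expC e C (c u) (s u)) (s' *: C + (e * c') *: (C *m C)).
Proof.
move=> dc ds i j; rewrite !mxE; under eq_fun do rewrite !mxE.
set y := \sum_k _; set z := C i j; set w := (i == j)%:R.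
have ds' : is_derive t (1 : R) (fun u => s u * z) (s' * z).
  apply: (is_derive_eq (is_deriveM ds (is_derive_cst z t (1 : R)))).
  by rewrite /GRing.scale /= mulr0 add0r mulrC.
have dc' : is_derive t (1 : R) (fun u => e * (c u - 1) * y) (e * c' * y).
  apply: (is_derive_eq (is_deriveM (is_deriveM (is_derive_cst e t (1 : R))
    (is_deriveB dc (is_derive_cst (1 : R) t (1 : R)))) (is_derive_cst y t (1 : R)))).
  by rewrite /GRing.scale /= !mulr0 subr0 addr0 add0r mulrC.
apply: (is_derive_eq (is_deriveD (is_deriveD (is_derive_cst w t (1 : R)) ds') dc')).
by rewrite add0r.
Qed.

Lemma Gsigma_intro h : \det h = 1 -> h^T *m I21 R *m h = I21 R -> Gsigma h.
Proof.
move=> dh hI; split=> //; have uh : h \in unitmx by rewrite unitmxE dh unitr1.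
have hV : invmx h = I21 R *m h^T *m I21 R.
  have hIh : I21 R *m h^T *m I21 R *m h = 1%:M.
    by rewrite -2!(mulmxA (I21 R)) hI I21K.
  by rewrite -[RHS](mulmxK uh) hIh mul1mx.
rewrite /sigma hV !trmx_mul trmxK trI21 !mulmxA I21K mul1mx -mulmxA I21K.
by rewrite mulmx1.
Qed.

(** The image of the curve is connected and contains the identity. *)
Lemma Hgroup_curve (g : R -> 'M[R]_3) : continuous g -> g 0 = 1%:M ->
  (forall t, Gsigma (g t)) -> forall t, Hgroup (g t).
Proof.
move=> gc g0 Gg t.
have cg : connected (range g).
  apply: connected_continuous_connected; last exact: continuous_subspaceT.
  by apply/connected_intervalP => x y _ _ z _.
apply: (connected_component_max _ _ cg); last by exists t.
- by exists 0.
- by move=> _ [u _ <-].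
Qed.

End CurvesInH.

Section Annihilation.
Variable R : realType.
Local Notation Q := (qspace R).
Implicit Types (C h : 'M[R]_3) (w : 'cV[R]_3) (x v : Q) (f : Q -> R).

(** The linearised isometry condition: [hat w] lies in the Lie algebra of SO(2,1). *)
Lemma tr_hat w : I21 R *m (hat w)^T *m I21 R = - hat w.
Proof.
rewrite /hat trmx_mul trI21 mulmxA -mulmxA I21K mulmx1 -mulmxN; congr (_ *m _).
by apply/matrixP; apply: ord3P; apply: ord3P; rewrite !mxE /=; ring.
Qed.

Lemma invmx_Gsigma h : Gsigma h -> invmx h = I21 R *m h^T *m I21 R.
Proof.
move=> [dh sh]; have uh : h \in unitmx by rewrite unitmxE dh unitr1.
rewrite -{2}sh /sigma !trmx_mul trmxK trI21 !mulmxA I21K mul1mx -mulmxA I21K.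
by rewrite mulmx1.
Qed.

Section OneParameter.
Variables (w : 'cV[R]_3) (e : R) (c s c' s' : R -> R).
Hypotheses (dc : forall t, is_derive t (1 : R) c (c' t))
  (ds : forall t, is_derive t (1 : R) s (s' t)).
Hypotheses (c0 : c 0 = 1) (s0 : s 0 = 0) (c'0 : c' 0 = 0) (s'0 : s' 0 = 1).
Let g t := expC e (hat w) (c t) (s t).
Hypothesis Gg : forall t, Gsigma (g t).

Let g0 : g 0 = 1%:M.
Proof. by rewrite /g /expC c0 s0 subrr mulr0 !scale0r !addr0. Qed.

Lemma Hgroup_expC t : Hgroup (g t).
Proof.
apply: Hgroup_curve => // {}t; apply/differentiable_continuous.
apply/derivable1_diffP.
by have [] := mx_is_derive (mx_derive_expC e (hat w) (dc t) (ds t)).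
Qed.

(** [f] is constant along the orbit curve t -> g(t) x, whose velocity at 0 is the bracket of [hat w]
    with x. *)
Lemma derive_invariant f x v : differentiable f x ->
  (forall h, Hgroup h -> f (qact h x) = f x) ->
  qmx v = hat w *m qmx x - qmx x *m hat w -> 'D_v f x = 0.
Proof.
move=> df fH vE.
have dg : mx_derive 0 (1 : R) g (hat w).
  move=> i j; have := mx_derive_expC e (hat w) (dc 0) (ds 0) i j.
  by rewrite c'0 s'0 mulr0 scale0r addr0 scale1r.
have dgV : mx_derive 0 (1 : R) (fun t => invmx (g t)) (- hat w).
  (* On the group the inverse is linear in the transpose, so it can be differentiated entry by
     entry. *)
  have -> : (fun t => invmx (g t)) = fun t => I21 R *m (g t)^T *m I21 R.
    by apply/funext => t; exact: invmx_Gsigma.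
  have dgT : mx_derive 0 (1 : R) (fun t => (g t)^T) (hat w)^T.
    by move=> i j; rewrite mxE; under eq_fun do rewrite mxE; exact: dg.
  have := mx_deriveM (mx_deriveM (mx_derive_cst _ _ (I21 R)) dgT)
    (mx_derive_cst _ _ (I21 R)).
  by rewrite mul0mx add0r mulmx0 addr0 tr_hat.
have dk : is_derive (0 : R) (1 : R) (fun t => qact (g t) x) v.
  apply: is_derive_qspace.
  have -> : (fun t => qmx (qact (g t) x)) = fun t => g t *m qmx x *m invmx (g t).
    by apply/funext => t; apply: qmx_qact; exact: Hgroup_expC.
  apply: mx_is_derive.
  have := mx_deriveM (mx_deriveM dg (mx_derive_cst _ _ (qmx x))) dgV.
  by rewrite mulmx0 addr0 g0 invmx1 mulmx1 mul1mx mulmxN -vE.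
have kx : qact (g 0) x = x.
  apply/val_inj; rewrite [LHS](qmx_qact x (Hgroup_expC 0)) g0.
  by rewrite mul1mx invmx1 mulmx1.
have [dk1 dkE] := dk.
have dk2 := (derivable1_diffP _ _).1 dk1.
have dfk : differentiable f (qact (g 0) x) by rewrite kx.
have : 'D_1 (f \o (fun t => qact (g t) x)) (0 : R) = 0.
  rewrite (_ : _ \o _ = cst (f x)); first exact: derive_cst.
  by apply/funext => t /=; apply/fH/Hgroup_expC.
rewrite deriveE; last exact: differentiable_comp.
by rewrite diff_comp //= kx -(deriveE _ dk2) dkE -deriveE.
Qed.
End OneParameter.

Definition mx33 (a00 a01 a02 a10 a11 a12 a20 a21 a22 : R) : 'M[R]_3 :=
  \matrix_(i, j) match val i, val j with
  | 0%N, 0%N => a00 | 0%N, 1%N => a01 | 0%N, _ => a02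
  | 1%N, 0%N => a10 | 1%N, 1%N => a11 | 1%N, _ => a12
  | _, 0%N => a20 | _, 1%N => a21 | _, _ => a22
  end.

Lemma rot3E (c s : R) : expC (-1) (hat (col3 0 0 1)) c s =
  mx33 c (- s) 0 s c 0 0 0 1.
Proof.
apply/matrixP; apply: ord3P; apply: ord3P; rewrite /expC hatE;
  rewrite !(mulmx3E, mxE) /= ?mulr1n ?mulr0n; ring.
Qed.

Lemma boost2E (c s : R) : expC 1 (hat (col3 0 1 0)) c s =
  mx33 c 0 s 0 1 0 s 0 c.
Proof.
apply/matrixP; apply: ord3P; apply: ord3P; rewrite /expC hatE;
  rewrite !(mulmx3E, mxE) /= ?mulr1n ?mulr0n; ring.
Qed.

Lemma boost1E (c s : R) : expC 1 (hat (col3 1 0 0)) c s =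
  mx33 1 0 0 0 c (- s) 0 (- s) c.
Proof.
apply/matrixP; apply: ord3P; apply: ord3P; rewrite /expC hatE;
  rewrite !(mulmx3E, mxE) /= ?mulr1n ?mulr0n; ring.
Qed.

Lemma Gsigma_rot3 (c s : R) : c ^+ 2 + s ^+ 2 = 1 ->
  Gsigma (expC (-1) (hat (col3 0 0 1)) c s).
Proof.
move=> cs; rewrite rot3E; apply: Gsigma_intro.
  by rewrite det3E !mxE /=; lra.
apply/matrixP; apply: ord3P; apply: ord3P;
  rewrite !mulmx3E !I21E !mxE /=; lra.
Qed.

Lemma Gsigma_boost2 (c s : R) : c ^+ 2 - s ^+ 2 = 1 ->
  Gsigma (expC 1 (hat (col3 0 1 0)) c s).
Proof.
move=> cs; rewrite boost2E; apply: Gsigma_intro.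
  by rewrite det3E !mxE /=; lra.
apply/matrixP; apply: ord3P; apply: ord3P;
  rewrite !mulmx3E !I21E !mxE /=; lra.
Qed.

Lemma Gsigma_boost1 (c s : R) : c ^+ 2 - s ^+ 2 = 1 ->
  Gsigma (expC 1 (hat (col3 1 0 0)) c s).
Proof.
move=> cs; rewrite boost1E; apply: Gsigma_intro.
  by rewrite det3E !mxE /=; lra.
apply/matrixP; apply: ord3P; apply: ord3P;
  rewrite !mulmx3E !I21E !mxE /=; lra.
Qed.

End Annihilation.

(** * The smooth element of Z(q) *)

Section SmoothElement.
Variable R : realType.
Local Notation Q := (qspace R).
Implicit Types (w : 'cV[R]_3) (x v : Q) (f : Q -> R).

(** Boosts are parametrised by their sinh, which makes cosh this function. The curve is not a
    one-parameter group, but it has the right tangent at the identity. *)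
Let coshs (t : R) : R := Num.sqrt (1 + t ^+ 2).

Let coshs_gt0 (t : R) : 0 < 1 + t ^+ 2.
Proof. by rewrite ltr_pwDl // sqr_ge0. Qed.

Let is_derive_coshs (t : R) :
  is_derive t (1 : R) coshs ((2 * coshs t)^-1 * (t + t)).
Proof.
apply: (@is_derive1_comp R Num.sqrt (fun t => 1 + t ^+ 2)).
  exact: is_derive1_sqrt.
apply: (is_derive_eq (is_deriveD (is_derive_cst (1 : R) t (1 : R))
  (is_deriveM (is_derive_id t (1 : R)) (is_derive_id t (1 : R))))).
by rewrite /GRing.scale /= add0r mulr1.
Qed.

Let coshs_hyp (t : R) : coshs t ^+ 2 - t ^+ 2 = 1.
Proof. by rewrite /coshs sqr_sqrtr ?addrK // ltW. Qed.

Let coshs0 : coshs 0 = 1.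
Proof. by rewrite /coshs expr0n addr0 sqrtr1. Qed.

Let dcoshs0 : (2 * coshs 0)^-1 * (0 + 0) = 0.
Proof. by rewrite addr0 mulr0. Qed.

Let dcos0 : - sin (0 : R) = 0.
Proof. by rewrite sin0 oppr0. Qed.

Lemma Hgroup_rot (t : R) :
  Hgroup (mx33 (cos t) (- sin t) 0 (sin t) (cos t) 0 0 0 1).
Proof.
rewrite -rot3E; apply: (Hgroup_expC (@is_derive_cos R) (@is_derive_sin R)) => //.
- exact: cos0.
- exact: sin0.
- by move=> {}t; apply: Gsigma_rot3; exact: cos2Dsin2.
Qed.

Lemma Hgroup_boost (c s : R) : 0 < c -> c ^+ 2 - s ^+ 2 = 1 ->
  Hgroup (mx33 c 0 s 0 1 0 s 0 c).
Proof.
move=> c0 cs; have -> : c = coshs s.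
  by rewrite /coshs -cs subrK sqrtr_sqr gtr0_norm.
rewrite -boost2E.
apply: (Hgroup_expC is_derive_coshs (fun t => is_derive_id t (1 : R))) => //.
by move=> t; exact: Gsigma_boost2.
Qed.

(** The differential of [f] is linear, so it suffices to treat the generators of one rotation and
    two boosts. *)
Lemma derive_tangent f w x v : differentiable f x ->
  (forall h, Hgroup h -> f (qact h x) = f x) ->
  qmx v = hat w *m qmx x - qmx x *m hat w -> 'D_v f x = 0.
Proof.
move=> df fH vE.
pose v_ w : Q := QSpace (hat_comm_qpred w (valP x)).
have D1 : 'D_(v_ (col3 1 0 0)) f x = 0.
  apply: (derive_invariant is_derive_coshs (fun t => is_derive_id t (1 : R))
    _ _ _ _ _ df) => //.
  by move=> t; exact: Gsigma_boost1.
have D2 : 'D_(v_ (col3 0 1 0)) f x = 0.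
  apply: (derive_invariant is_derive_coshs (fun t => is_derive_id t (1 : R))
    _ _ _ _ _ df) => //.
  by move=> t; exact: Gsigma_boost2.
have D3 : 'D_(v_ (col3 0 0 1)) f x = 0.
  apply: (derive_invariant (@is_derive_cos R) (@is_derive_sin R) _ _ _ _ _ df) => //.
  - exact: cos0.
  - exact: sin0.
  - exact: cos0.
  by move=> t; apply: Gsigma_rot3; exact: cos2Dsin2.
have -> : v = w i0 0 *: v_ (col3 1 0 0) + w i1 0 *: v_ (col3 0 1 0)
    + w i2 0 *: v_ (col3 0 0 1).
  apply/val_inj; rewrite !linearD !linearZ [LHS]vE /=.
  have -> : hat w = w i0 0 *: hat (col3 1 0 0) + w i1 0 *: hat (col3 0 1 0)
      + w i2 0 *: hat (col3 0 0 1).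
    by rewrite !hatE; apply/matrixP; apply: ord3P; apply: ord3P;
      rewrite !mxE /=; ring.
  rewrite !mulmxDl !mulmxDr -!(scalemxAl, scalemxAr) !scalerBr.
  by rewrite !opprD addrACA [X in X + _]addrACA.
move: D1 D2 D3; rewrite !deriveE // => D1 D2 D3.
by rewrite !linearD !linearZ /= D1 D2 D3 !scaler0 !addr0.
Qed.

Lemma qC_subproof x : map_mx (real_complex R) (qmx x) \in @qpred R[i].
Proof.
have /qpred3P[h10 h20 h21 h22] := valP x; apply/qpred3P.
by rewrite !mxE h10 h20 h21 h22 !rmorphB !rmorphN.
Qed.

Definition qC x : qspace R[i] := QSpace (qC_subproof x).

Lemma qRe_qC x : qRe (qC x) = x.
Proof. by apply/val_inj/matrixP => i j; rewrite !mxE. Qed.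

Lemma qIm_qC x : qIm (qC x) = 0.
Proof. by apply/val_inj/matrixP => i j; rewrite !mxE. Qed.

Lemma Xmx_qpred x : Xmx (qmx x) \in @qpred R.
Proof. by apply/rpredZ/hat_comm_qpred; exact: valP. Qed.

Definition Xfield : vfield R := fun x => qC (QSpace (Xmx_qpred x)).

Lemma smooth_cst (c : R) : smooth (fun _ : Q => c).
Proof. by move=> n; apply: Ck_onT; exact: Ck_on_cst. Qed.

Lemma smooth_differentiable f x : smooth f -> differentiable f x.
Proof. by move=> /(_ 1%N) [/(_ x)]. Qed.

Lemma Xfield_Zq : Zq Xfield.
Proof.
split.
- move=> i j; split; under eq_fun do rewrite mxE /=.
    exact: Xmx_smooth.
  exact: smooth_cst.
- move=> h x Hh; have [dh sh] := connected_component_sub Hh.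
  apply/val_inj; rewrite /= (qmx_qactC _ Hh) /= qmx_qact // Xmx_conj //; last exact: valP.
  by rewrite !map_mxM map_invmx.
- move=> f [[Ref Imf] fH] x; rewrite /vf_apply qRe_qC qIm_qC.
  have tan g : smooth g -> (forall h, Hgroup h -> g (qact h x) = g x) ->
      'D_(QSpace (Xmx_qpred x)) g x = 0.
    (* The scalar factor is absorbed into the eigenvector, which exhibits the value as a tangent
       vector to the orbit. *)
    move=> gs gH; set k := flat 0 (inv2 (qmx x) - 2^-1) / Num.sqrt (Bnorm (qmx x)).
    apply: (@derive_tangent g (k *: Avec (qmx x))) => //.
      exact: smooth_differentiable.
    by rewrite hatZ -!(scalemxAl, scalemxAr) -scalerBr.
  rewrite /cderive !derive0 !tan //; first by rewrite mulr0 addr0.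
  + by move=> h Hh; rewrite fH.
  + by move=> h Hh; rewrite fH.
Qed.

End SmoothElement.

(** * Polynomial elements of Z(q) *)

Section PolynomialElements.
Variable R : realType.
Local Notation Q := (qspace R).
Implicit Types (x v : Q) (Y : vfield R).

Lemma mx_derive_qmx x v : mx_derive x v (@qmx R) (qmx v).
Proof.
move=> i j; have cij := @qcoord_continuous R i j.
have dij : differentiable (@qcoord R i j) x by exact: linear_differentiable.
split; first exact: diff_derivable dij.
by rewrite -[LHS]/('D_v (@qcoord R i j) x) (deriveE v dij) diff_lin.
Qed.

Lemma derive_inv2 x v : 'D_v (fun y => inv2 (qmx y)) x = - \tr (qmx x *m qmx v).
Proof.
have dx := mx_derive_qmx x v.
have [_ E] := is_deriveN (is_deriveM (is_derive_mxtrace (mx_deriveM dx dx))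
  (is_derive_cst (2^-1 : R) x v)).
rewrite [LHS]E /GRing.scale /= mulr0 add0r mxtraceD (mxtrace_mulC (qmx v)).
by field.
Qed.

Lemma derive_inv3 x v :
  'D_v (fun y => inv3 (qmx y)) x = - \tr (qmx x *m qmx x *m qmx v).
Proof.
have dx := mx_derive_qmx x v.
have [_ E] := is_deriveN (is_deriveM (is_derive_mxtrace (mx_deriveM
  (mx_deriveM dx dx) dx)) (is_derive_cst (3^-1 : R) x v)).
rewrite [LHS]E /GRing.scale /= mulr0 add0r mulmxDl !mxtraceD.
rewrite -(mulmxA (qmx v)) (mxtrace_mulC (qmx v)).
rewrite -(mulmxA (qmx x) (qmx v)) (mxtrace_mulC (qmx x) (_ *m _)) -(mulmxA (qmx v)).
rewrite (mxtrace_mulC (qmx v)).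
by field.
Qed.

Lemma vf_apply_real Y (g : Q -> R) x :
  vf_apply Y (fun y => real_complex R (g y)) x = 0 ->
  'D_(qRe (Y x)) g x = 0 /\ 'D_(qIm (Y x)) g x = 0.
Proof.
have D0 v : 'D_v (fun _ : Q => 0 : R) x = 0 by exact: derive_cst.
rewrite /vf_apply /cderive /= !D0 => /eqP; rewrite eq_complex /=.
by rewrite !(mul0r, mulr0, mul1r, subr0, add0r, addr0) => /andP[/eqP-> /eqP->].
Qed.

Lemma CinfH_inv2 : CinfH (fun x : Q => real_complex R (inv2 (qmx x))).
Proof.
split; first split; first by move=> n; exact/Ck_onT/Ck_on_inv2/openT.
  exact: smooth_cst.
move=> h x Hh; have [dh sh] := connected_component_sub Hh.
by rewrite qmx_qact // inv2_conj.
Qed.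

Lemma CinfH_inv3 : CinfH (fun x : Q => real_complex R (inv3 (qmx x))).
Proof.
split; first split; first by move=> n; exact/Ck_onT/Ck_on_inv3/openT.
  exact: smooth_cst.
move=> h x Hh; have [dh sh] := connected_component_sub Hh.
by rewrite qmx_qact // inv3_conj.
Qed.

Lemma diag_subproof (a : R) : mx33 a 0 0 0 0 0 0 0 (- a) \in @qpred R.
Proof. by apply/qpred3P; rewrite !mxE /= !oppr0 addr0. Qed.

Definition qdiag (a : R) : Q := QSpace (diag_subproof a).

Lemma slice_subproof (d : R) : mx33 d 0 1 0 0 0 (-1) 0 (- d) \in @qpred R.
Proof. by apply/qpred3P; rewrite !mxE /= !oppr0 addr0. Qed.

(** A line in q with eigenvalues 0 and the two square roots of d^2 - 1: it joins real-diagonalisable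
    points (d > 1) to a point with nonreal eigenvalues (d = 0). *)
Definition qslice (d : R) : Q := QSpace (slice_subproof d).

(** Equivariance cleared of inverses, so that entries can be compared directly. *)
Lemma vf_invariant_comm Y h x y : vf_invariant Y -> Hgroup h ->
  h *m qmx x = qmx y *m h ->
  let hC := map_mx (real_complex R) h in
  qmx (Y y) *m hC = hC *m qmx (Y x).
Proof.
move=> Yinv Hh hxy hC; have [dh _] := connected_component_sub Hh.
have uh : h \in unitmx by rewrite unitmxE dh unitr1.
have -> : y = qact h x.
  by apply/val_inj; rewrite /= qmx_qact // hxy mulmxK.
rewrite Yinv // qmx_qactC // mulmxKV //.
by rewrite map_unitmx.
Qed.

Lemma Zq_qdiag Y (a : R) : a != 0 -> Zq Y ->
  [/\ qmx (Y (qdiag a)) i0 i0 = 0, qmx (Y (qdiag a)) i2 i2 = 0,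
      qmx (Y (qdiag a)) i0 i2 = 0 & qmx (Y (qdiag a)) i2 i0 = 0].
Proof.
move=> a0 [_ Yinv Yann].
have [D2r D2i] := vf_apply_real (Yann _ CinfH_inv2 (qdiag a)).
have [D3r D3i] := vf_apply_real (Yann _ CinfH_inv3 (qdiag a)).
(* The two differentials at [qdiag a] are -a (v00 - v22) and -a^2 (v00 + v22). *)
have diag0 v : 'D_v (fun y => inv2 (qmx y)) (qdiag a) = 0 ->
    'D_v (fun y => inv3 (qmx y)) (qdiag a) = 0 ->
    qmx v i0 i0 = 0 /\ qmx v i2 i2 = 0.
  rewrite derive_inv2 derive_inv3 !tr3E !mulmx3E !mxE /=.
  rewrite !(mul0r, mulr0, add0r, addr0) => /eqP.
  rewrite mulNr opprB subr_eq0 => /eqP /(mulfI a0) E.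
  rewrite -E mulrNN -mulr2n => /eqP.
  rewrite oppr_eq0 mulrn_eq0 !mulf_eq0 (negbTE a0) /= => /eqP v0.
  by split.
have [r00 r22] := diag0 _ D2r D3r; have [m00 m22] := diag0 _ D2i D3i.
have Y02 : qmx (Y (qdiag a)) i0 i2 = 0.
  (* The rotation by pi is diag(-1, -1, 1); it fixes [qdiag a] and negates the entry in question. *)
  have Hpi := Hgroup_rot (pi : R); rewrite cospi sinpi oppr0 in Hpi.
  set h := mx33 _ _ _ _ _ _ _ _ _ in Hpi.
  have hq : h *m qmx (qdiag a) = qmx (qdiag a) *m h.
    by apply/matrixP; apply: ord3P; apply: ord3P; rewrite !mulmx3E !mxE /=; ring.
  have := congr1 (fun M : 'M[R[i]]_3 => M i0 i2) (vf_invariant_comm Yinv Hpi hq).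
  rewrite /= !mulmx3E !mxE /= !(rmorph0, rmorph1, rmorphN).
  rewrite !(mulr0, mul0r, mulr1, mulN1r, add0r, addr0) => E.
  have {}E : qmx (Y (qdiag a)) i0 i2 *+ 2 = 0 by rewrite mulr2n {1}E addNr.
  by move/eqP: E; rewrite mulrn_eq0 => /eqP.
split=> //.
- move: r00 m00; rewrite !mxE; case: (qmx _ i0 i0) => u v /= -> -> //.
- move: r22 m22; rewrite !mxE; case: (qmx _ i2 i2) => u v /= -> -> //.
- have /qpred3P[_ -> _ _] := valP (Y (qdiag a)).
  by rewrite Y02 oppr0.
Qed.

Lemma Zq_qslice Y (d : R) : 1 < d -> Zq Y -> qmx (Y (qslice d)) i0 i0 = 0.
Proof.
move=> d1 ZY; have [_ Yinv _] := ZY.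
have d0 : 0 < d by exact: lt_trans d1.
have dd1 : 0 < d ^+ 2 - 1 by rewrite subr_gt0 expr_gt1 ?ltW.
pose a := Num.sqrt (d ^+ 2 - 1); have a0 : 0 < a by rewrite sqrtr_gt0.
have aE : a ^+ 2 = d ^+ 2 - 1 by rewrite sqr_sqrtr // ltW.
(* (1, 0, -b) is an eigenvector of [qslice d] for [a]. It is spacelike since b^2 < 1, and
   normalising it gives the first column (c, 0, s) of a boost. *)
pose b := d - a.
have bE : b * (d + a) = 1 by rewrite /b -subr_sqr aE; ring.
have b_gt0 : 0 < b by rewrite -(pmulr_lgt0 _ (addr_gt0 d0 a0)) bE.
have b_lt1 : b ^+ 2 < 1.
  rewrite expr_lt1 ?ltW // -bE ltr_pMr //.
  by rewrite (lt_le_trans d1) // lerDl ltW.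
pose c := (Num.sqrt (1 - b ^+ 2))^-1; pose s := - (c * b).
have c0 : 0 < c by rewrite invr_gt0 sqrtr_gt0 subr_gt0.
have cs : c ^+ 2 - s ^+ 2 = 1.
  have -> : c ^+ 2 - s ^+ 2 = c ^+ 2 * (1 - b ^+ 2) by rewrite /s; ring.
  rewrite /c exprVn sqr_sqrtr ?mulVf //; last by rewrite ltW // subr_gt0.
  by rewrite gt_eqF // subr_gt0.
have Hb := Hgroup_boost c0 cs.
have comm : mx33 c 0 s 0 1 0 s 0 c *m qmx (qdiag a) =
    qmx (qslice d) *m mx33 c 0 s 0 1 0 s 0 c.
  have E1 : c * a = d * c + s by rewrite /s /b; ring.
  have E2 : - (s * a) = d * s + c.
    rewrite -[X in _ = _ + X]mulr1 -bE /s; ring.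
  move: E1 E2; clearbody a c s => E1 E2.
  by apply/matrixP; apply: ord3P; apply: ord3P;
    rewrite !mulmx3E !mxE /=; lra.
have := vf_invariant_comm Yinv Hb comm.
have [w00 w22 w02 w20] := Zq_qdiag (lt0r_neq0 a0) ZY.
move=> /= E; have E0 := congr1 (fun M : 'M[R[i]]_3 => M i0 i0) E.
have E2 := congr1 (fun M : 'M[R[i]]_3 => M i0 i2) E.
move: E0 E2; rewrite /= !mulmx3E w00 w22 w02 w20 !mxE /=.
rewrite !(mulr0, mul0r, add0r, addr0) => E0 E2.
have := congr1 (real_complex R) cs; rewrite rmorphB !rmorphXn rmorph1 => csC.
(* [E0] and [E2] form a homogeneous linear system in [z], [z'] of determinant c^2 - s^2 = 1. *)
rewrite -[LHS]mulr1 -csC.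
set z := qmx _ _ _ in E0 E2 *; set z' := qmx _ _ _ in E0 E2.
set c' := real_complex R c in E0 E2 *; set s' := real_complex R s in E0 E2 *.
have -> : z * (c' ^+ 2 - s' ^+ 2) =
  (z * c' + z' * s') * c' - (z * s' + z' * c') * s' by ring.
by rewrite E0 E2 !mul0r subr0.
Qed.

End PolynomialElements.

(** * Restriction of polynomial elements to a line, and conclusion *)

Section NonGeneration.
Variable R : realType.
Local Notation Q := (qspace R).

(** The roots start at 2 because [Zq_qslice] gives vanishing for d > 1. *)
Lemma natr_roots_eq0 (F : numFieldType) (P : {poly F}) :
  (forall k : nat, P.[k.+2%:R] = 0) -> P = 0.
Proof.
move=> P0; apply/eqP/negPn/negP => PN0.
pose s : seq F := [seq k.+2%:R | k <- iota 0 (size P)].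
have : (size s < size P)%N.
  apply: max_poly_roots => //.
    by apply/allP => _ /mapP[k _ ->]; exact/rootP.
  rewrite map_inj_uniq ?iota_uniq // => k l /eqP.
  by rewrite eqr_nat => /eqP[].
by rewrite size_map size_iota ltnn.
Qed.

Lemma vf_polynomial_qslice (Y : vfield R) i j : vf_polynomial Y ->
  exists P : {poly R[i]}, forall d : R,
    qmx (Y (qslice d)) i j = P.[real_complex R d].
Proof.
move=> /(_ i j)[p pE].
pose A0 : 'M[R]_3 := mx33 0 0 1 0 0 0 (-1) 0 0.
pose A1 : 'M[R]_3 := mx33 1 0 0 0 0 0 0 0 (-1).
(* The entries of [qslice d] are affine in [d]; substituting them into [p] leaves a polynomial in
   one variable. *)
pose L (k : 'I_(3 * 3)) : {poly R[i]} :=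
  (real_complex R (mxvec A0 ord0 k))%:P + (real_complex R (mxvec A1 ord0 k))%:P * 'X.
exists (\sum_(m <- mpoly.msupp p)
  (mpoly.mcoeff m p)%:P * \prod_(k < 3 * 3) L k ^+ mpoly.fun_of_multinom m k) => d.
rewrite pE mpoly.mevalE horner_sum; apply: eq_bigr => m _.
rewrite hornerM hornerC horner_prod; congr (_ * _); apply: eq_bigr => k _.
rewrite horner_exp; congr (_ ^+ _); rewrite /L !hornerE.
have -> : qmx (qslice d) = A0 + d *: A1.
  by apply/matrixP; apply: ord3P; apply: ord3P; rewrite !mxE /=; ring.
by rewrite linearD linearZ /= !mxE rmorphD rmorphM mulrC.
Qed.

Lemma Zq_polynomial_qslice0 (Y : vfield R) : Zq Y -> vf_polynomial Y ->
  qmx (Y (qslice 0)) i0 i0 = 0.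
Proof.
move=> ZY /(vf_polynomial_qslice i0 i0)[P PE].
rewrite PE (_ : P = 0) ?horner0 //; apply: natr_roots_eq0 => k.
have := PE k.+2%:R; rewrite rmorph_nat => <-.
by apply: Zq_qslice => //; rewrite ltr1n.
Qed.

(** The characteristic polynomial is l^3 + l, so the real eigenvalue is 0, with the second basis
    vector as eigenvector. The bracket then has top left entry -2, and the cutoff is positive
    because [inv2] is 1. *)
Lemma Xfield_qslice0 : qmx (Xfield (qslice (0 : R))) i0 i0 != 0.
Proof.
set x := qmx (qslice (0 : R)).
have qx : x \in @qpred R by exact: valP.
have p1 : inv2 x = 1 by rewrite inv2E // /x !mxE /=; ring.
have q0 : inv3 x = 0 by rewrite inv3E // /x !mxE /=; ring.
have p0 : 0 < inv2 x by rewrite p1.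
have l0 : lam x = 0.
  have := lam_root p0; rewrite /is_root p1 q0 => E.
  have {}E : lam x * (lam x ^+ 2 + 1) = 0 by rewrite -E; ring.
  move/eqP: E; rewrite mulf_eq0 => /orP[/eqP //|].
  by rewrite gt_eqF // ltr_wpDl // sqr_ge0.
have uE : uvec x (e3 R) = col3 0 1 0.
  apply/matrixP => i j; rewrite ord1; move: i; apply: ord3P;
  by rewrite /uvec -mulmxA mulmx3E hatE /e3 /col3 !(mulmx3E, mxE) /=; ring.
have AE : Avec x = col3 0 1 0.
  rewrite /Avec l0 uE; apply/matrixP => i j; rewrite ord1; move: i; apply: ord3P;
  by rewrite mulmx3E !adjlE p1 /col3 !mxE /=; ring.
rewrite mxE fmorph_eq0 -/x mxE mulf_neq0 //.
  rewrite mulf_neq0 ?invr_eq0 // gt_eqF ?sqrtr_gt0 //.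
    rewrite /flat ifT; last by rewrite p1 subr_gt0 invf_lt1 // ltr1n.
    by rewrite expr0 mul1r expR_gt0.
  exact: Bnorm_gt0.
rewrite AE hatE /col3 !(mulmx3E, mxE) /=.
have -> : 0 * 0 + - 0 * 0 + 1 * -1 - (0 * 0 + 0 * 0 + 1 * 1) = - 2 :> R by ring.
by rewrite oppr_eq0 pnatr_eq0.
Qed.

End NonGeneration.

Theorem mainTheorem2 (R : realType) :
  ~ vf_generates [set X | @Zq R X /\ vf_polynomial X] (@Zq R).
Proof.
move=> /(_ _ (Xfield_Zq R))[n [a [Y [_ YS XE]]]].
have /negP[] := @Xfield_qslice0 R; rewrite XE; apply/eqP.
rewrite (_ : qmx _ = \sum_(k < n) a k (qslice 0) *: qmx (Y k (qslice 0))); last first.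
  by rewrite -[LHS]/(val _) raddf_sum; apply: eq_bigr.
rewrite summxE big1 // => k _; rewrite mxE.
by have [ZY pY] := YS k; rewrite Zq_polynomial_qslice0 // mulr0.
Qed.
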